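(* Consider the secretary problem in which the order of arrival of the $n$ ranked items is biased via a Mallows distribution, and let $\mathcal{P}_n^{q}(\mathcal{S}(n,M))$ denote the probability that the strategy $\mathcal{S}(n,M)$ successfully selects the item of highest rank when the Mallows parameter is $q$. (i) Let $q_n=1-\frac cn$, where $c>0$. Then the asymptotically optimal strategy is $\mathcal{S}(n,M_n^* )$, where $$M_n^*\sim n\Big(\frac1c\log\big(1+\frac{e^c-1}{e}\big)\Big),$$ and the corresponding limiting probability of success is $\frac1e$: $$\lim_{n\to\infty}\mathcal{P}_n^{q_n}(\mathcal{S}(n,M_n^* ))=\frac1e.$$ Also, $\lim_{c\to\infty}\frac1c\log\big(1+\frac{e^c-1}{e}\big)=1$ and $\lim_{c\to0}\frac1c\log\big(1+\frac{e^c-1}{e}\big)=\frac1e$. (ii) Let $q_n=1-\frac{c}{n^\alpha}$, where $c>0$ and $\alpha\in(0,1)$. Then the asymptotically optimal strategy is $\mathcal{S}(n,M_n^* )$, where $$n-M_n^*\sim\frac{n^\alpha}{c},$$ and the corresponding limiting probability of success is $\frac1e$: $$\lim_{n\to\infty}\mathcal{P}_n^{q_n}(\mathcal{S}(n,M_n^* ))=\frac1e.$$ (iii) Let $q\in(0,1)$. Then the asymptotically optimal strategy is $\mathcal{S}(n,M_n^* )$, where $$M_n^*=n-L,\ \text{ if }\ \frac{L-1}{L}<q\le\frac{L}{L+1},\ L=1,2,\cdots.$$ The corresponding limiting probability of success is given by $$\lim_{n\to\infty}\mathcal{P}_n^{q}(\mathcal{S}(n,M_n^* ))=(1-q)q^{L-1}L,\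 \text{ if }\ \frac{L-1}{L}<q\le\frac{L}{L+1},\ L=1,2,\cdots.$$ In particular, $$\lim_{n\to\infty}\mathcal{P}_n^{q}(\mathcal{S}(n,M_n^* ))>\frac1e,\ \ 0<q<1;$$ $$\lim_{q\to1}\lim_{n\to\infty}\mathcal{P}_n^{q}(\mathcal{S}(n,M_n^* ))=\frac1e;$$ and $$\lim_{n\to\infty}\mathcal{P}_n^{q}(\mathcal{S}(n,M_n^* ))=1-q,\ \ 0<q\le\frac12.$$
   Context: Let $S_n$ be the set of permutations $\sigma=\sigma_1\sigma_2\cdots\sigma_n$ of $[n]=\{1,\dots,n\}$, and let $\mathrm{inv}(\sigma)$ be the number of inversions of $\sigma$, i.e. the number of pairs $i<j$ with $\sigma_i>\sigma_j$. The Mallows distribution with parameter $q>0$ is the probability distribution $P_n^q$ on $S_n$ for which $P_n^q(\sigma)$ is proportional to $q^{\mathrm{inv}(\sigma)}$. Secretary problem with Mallows-biased arrival: $n$ ranked items are revealed, one at a time, to an observer whose objective is to select the item with the highest rank. The rank of the $j$th item to arrive is $\sigma_j$, where $\sigma\in S_n$ is distributed according to $P_n^q$; the number $n$ represents the highest rank and $1$ the lowest. At each stage the observer knows only the relative ranks of the items that have arrived so far, and must either select the current item, in which case the process terminates, or reject it and continue to the next item. If the first $n-1$ items are rejected, the $n$th and final item must be accepted. Success means selecting the item of highest rank. The asymptotically optimal strategy is the observer's optimal strategy for this objective, asymptotically as $n\to\infty$. For $0\le M\le n-1$, $\mathcal{S}(n,M)$ denotes the strategy whereby the observer rejects the first $M$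 items and then selects the first later-arriving item whose rank is higher than that of any of the first $M$ items, if such an item exists (for $M=0$, the first item is selected). $\mathcal{P}_n^q(\mathcal{S}(n,M))$ denotes the probability, when the order of arrival is distributed according to $P_n^q$, that this strategy selects the item of highest rank. The notation $a_n\sim b_n$ means $a_n/b_n\to1$ as $n\to\infty$. *)

(* Defs.v *)
From HB Require Import structures.
From mathcomp Require Import all_boot all_order all_fingroup all_algebra.
From mathcomp Require Import all_classical all_reals all_analysis.
Set Implicit Arguments.
Unset Strict Implicit.
Unset Printing Implicit Defensive.
Import Order.TTheory GRing.Theory Num.Theory.
Import numFieldNormedType.Exports.
Local Open Scope classical_set_scope.
Local Open Scope ring_scope.

(* A permutation s : 'S_n is an order of arrival: the item arriving at (0-based)
   time j has rank s j + 1, so that n is the highest rank. *)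

Definition inv (n : nat) (s : 'S_n) : nat :=
  #|[set p : 'I_n * 'I_n | (p.1 < p.2)%N && (s p.2 < s p.1)%N]|%SET.

Definition mallows (R : realType) (n : nat) (q : R) (s : 'S_n) : R :=
  q ^+ inv s / \sum_(t : 'S_n) q ^+ inv t.

(* The relative ranks (1 = lowest), among the first k items to arrive, of those
   k items, listed in order of arrival. *)
Definition relative_ranks (n : nat) (s : 'S_n) (k : nat) : seq nat :=
  [seq #|[set i : 'I_n | (i < k)%N && (s i <= s j)%N]|%SET
    | j <- take k (enum 'I_n)].

(* Given the relative ranks of the items that have arrived so far, a strategy
   answers true to select the current (last arrived) item. The size of the
   argument tells how many items have arrived. *)
Definition strategy : Type := seq nat -> bool.

(* The 0-based arrival time of the selected item. If none of the first n - 1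
   items is selected, find returns n - 1: the last item is accepted,
   whatever d says. *)
Definition selected (n : nat) (d : strategy) (s : 'S_n) : nat :=
  find (fun j => d (relative_ranks s j.+1)) (iota 0 n.-1).

Definition success (n : nat) (d : strategy) (s : 'S_n) : bool :=
  [exists j : 'I_n, (nat_of_ord j == selected d s) && ((s j).+1 == n)].

Definition success_prob (R : realType) (n : nat) (q : R) (d : strategy) : R :=
  \sum_(s : 'S_n | success d s) mallows q s.

(* S(n,M); the number n of items only enters through [selected]. *)
Definition threshold (M : nat) : strategy := fun h =>
  (M < size h)%N && all (fun r => (r < last 0 h)%N) (take M h).

Definition optimal (R : realType) (n : nat) (q : R) (d : strategy) : Prop :=
  forall d' : strategy, success_prob n q d' <= success_prob n q d.

Definition optimal_value (R : realType) (n : nat) (q : R) : R :=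
  sup (range (@success_prob R n q)).

Definition asymp_equiv (R : realType) (a b : nat -> R) : Prop :=
  (fun n => a n / b n) @ \oo --> (1 : R).

Definition asymptotically_optimal (R : realType) (q : nat -> R)
    (d : nat -> strategy) : Prop :=
  asymp_equiv (fun n => success_prob n (q n) (d n))
              (fun n => optimal_value n (q n)).

Definition rho (R : realType) (c : R) : R :=
  c^-1 * ln (1 + (expR c - 1) / expR 1).

Definition band (R : realType) (q : R) (L : nat) : Prop :=
  (0 < L)%N /\ (L%:R - 1) / L%:R < q <= L%:R / (L%:R + 1).

(* The L with [band q L]; it exists (and is unique) for 0 < q < 1. *)
Definition Lstar (R : realType) (q : R) : nat := xget 0%N [set L | band q L].

(* The limiting probability of success of S(n, n - L) for fixed q, L = Lstar q.
   [limn] is total; the statement using it also asserts convergence. *)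
Definition limit_success (R : realType) (q : R) : R :=
  limn (fun n => success_prob n q (threshold (n - Lstar q))).

(* Main.v *)
(* Inserting the items one after the other (sum over S_{k+1} = sum over the rank of
   the last item and over S_k) shows that under the Mallows law the indicators
   "the item of (0-based) time k is a record" are independent of the relative ranks
   seen before, with probability p_k = (1 - q) / (1 - q^{k+1}).  Success means
   stopping on the last record, so Bruss' odds theorem applies: with odds
   r_k = p_k / (1 - p_k), the threshold M is optimal iff
   sum_{j > M} r_j <= 1 and (M = 0 or sum_{j >= M} r_j >= 1), and for M > 0 its
   success probability is prod_{j >= M} (1 - p_j) * sum_{j >= M} r_j.

   With y_k = q^{-k} - 1 one has r_k = y_{k+1} / y_k - 1, so that the product is
   z = y_M / y_n and the sum lies between ln (1 / z) and (y_{M+1} / y_M) ln (1 / z).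
   If q_n -> 1 while n (1 - q_n) stays bounded below, this forces z -> 1/e for
   optimal M, and z -> 1/e gives success probability -> -z ln z -> 1/e; it remains
   to translate z -> 1/e into the asymptotics of M in (i) and (ii).  For fixed q the
   last m odds all tend to 1/q - 1 from above, which gives (iii). *)
Require Import Defs.
From HB Require Import structures.
From mathcomp Require Import all_boot all_order all_fingroup all_algebra.
From mathcomp Require Import all_classical all_reals all_analysis.
From mathcomp Require Import zify ring lra.
Set Implicit Arguments.
Unset Strict Implicit.
Unset Printing Implicit Defensive.
Import Order.TTheory GRing.Theory Num.Theory.
Import numFieldNormedType.Exports.
Local Open Scope classical_set_scope.
Local Open Scope ring_scope.

(** * Inserting a last item: product structure of the Mallows law *)

Lemma sum_lift_perm (V : nmodType) (n : nat) (F : 'S_n.+1 -> V) :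
  \sum_s F s = \sum_(j < n.+1) \sum_(s : 'S_n) F (lift_perm ord_max j s).
Proof.
rewrite pair_bigA /=; apply: reindex; apply: onW_bij.
apply: inj_card_bij => [[j s] [k t] /= eq_lift|].
  have eq_jk : j = k by rewrite -(lift_perm_id ord_max j s) eq_lift lift_perm_id.
  rewrite -{}eq_jk in eq_lift *; congr pair; apply/permP => i.
  by apply: (@lift_inj _ j); rewrite -!(lift_perm_lift ord_max) eq_lift.
by rewrite card_prod card_ord !card_Sn factS.
Qed.

Lemma lt_lift (n : nat) (j : 'I_n.+1) (a b : 'I_n) :
  (lift j a < lift j b)%N = (a < b)%N.
Proof. by rewrite /= /bump; case: leqP; case: leqP => /=; lia. Qed.

Lemma le_lift (n : nat) (j : 'I_n.+1) (a b : 'I_n) :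
  (lift j a <= lift j b)%N = (a <= b)%N.
Proof. by rewrite leqNgt lt_lift -leqNgt. Qed.

Lemma widen_ord_lift (n : nat) (a : 'I_n) : widen_ord (leqnSn n) a = lift ord_max a.
Proof. by apply: val_inj; rewrite /= /bump leqNgt ltn_ord. Qed.

Lemma sum_ord_ge (n : nat) (j : nat) : (\sum_(a < n) (j <= a : nat) = n - j)%N.
Proof. by elim: n => [|n IH]; rewrite ?big_ord0 ?big_ord_recr //= IH; lia. Qed.

Lemma inv_sum (n : nat) (s : 'S_n) :
  Defs.inv s = (\sum_(a < n) \sum_(b < n) ((a < b) && (s b < s a) : nat))%N.
Proof.
rewrite /Defs.inv -sum1_card pair_bigA [RHS]big_mkcond [LHS]big_mkcond /=.
by apply: eq_bigr => p _; rewrite inE; case: ifP.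
Qed.

(** Since [lift] preserves order, earlier pairs keep their inversions; the last item adds one with
    each of the [n - j] earlier items whose rank is raised above [j]. *)
Lemma inv_lift_perm (n : nat) (j : 'I_n.+1) (s : 'S_n) :
  Defs.inv (lift_perm ord_max j s) = (Defs.inv s + (n - j))%N.
Proof.
rewrite !inv_sum big_ord_recr /= [X in (_ + X)%N]big1 ?addn0 => [|b _].
  have -> : (n - j = \sum_(a < n) (j <= s a))%N.
    by rewrite -(sum_ord_ge n j) (reindex_inj (@perm_inj _ s)).
  rewrite -big_split.
  apply: eq_bigr => a _; rewrite big_ord_recr /= widen_ord_lift.
  rewrite lift_perm_id lift_perm_lift ltn_ord /=; congr addn.
    by apply: eq_bigr => b _; rewrite widen_ord_lift !lift_perm_lift lt_lift.
  by rewrite /bump; case: leqP; lia.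
by rewrite ltnNge -ltnS ltn_ord.
Qed.

Definition prob (R : realType) (q : R) (n : nat) (A : pred 'S_n) : R :=
  \sum_(s | A s) mallows q s.

(** The truncated geometric law of the rank of the last among [k + 1] items; [j = k] means a
    record. *)
Definition rank_prob (R : realType) (q : R) (k j : nat) : R :=
  q ^+ (k - j) * (1 - q) / (1 - q ^+ k.+1).

Definition record_prob (R : realType) (q : R) (k : nat) : R :=
  (1 - q) / (1 - q ^+ k.+1).

Section MallowsLift.
Variables (R : realType) (q : R).
Hypothesis q01 : 0 < q < 1.

Let q_gt0 : 0 < q. Proof. by case/andP: q01. Qed.
Let q_lt1 : q < 1. Proof. by case/andP: q01. Qed.

Lemma subr1_expr_gt0 k : 0 < 1 - q ^+ k.+1.
Proof. by rewrite subr_gt0 exprn_ilt1 // ltW. Qed.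

Lemma sum_expr_rev k : \sum_(j < k.+1) q ^+ (k - j) = (1 - q ^+ k.+1) / (1 - q).
Proof.
rewrite (reindex_inj rev_ord_inj) /=.
under eq_bigr => j _ do rewrite subSS subKn ?(leq_ord j) //.
apply: (mulIf (x := 1 - q)); first by rewrite subr_eq0 gt_eqF.
rewrite divfK ?subr_eq0 ?gt_eqF //.
by rewrite -[1 - q ^+ _]opprB subrX1; ring.
Qed.

Lemma mallows_total_gt0 n : 0 < \sum_(t : 'S_n) q ^+ Defs.inv t.
Proof.
rewrite (bigD1 1%g) //= ltr_pwDl ?exprn_gt0 // sumr_ge0 // => s _.
by rewrite exprn_ge0 // ltW.
Qed.

Lemma mallows_ge0 n (s : 'S_n) : 0 <= mallows q s.
Proof. by rewrite divr_ge0 ?exprn_ge0 // ltW // mallows_total_gt0. Qed.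

(** The inversion count is additive and the normalising sum factors accordingly, so the rank of the
    last item is independent of the order of the earlier ones. *)
Lemma mallows_lift n (j : 'I_n.+1) (s : 'S_n) :
  mallows q (lift_perm ord_max j s) = rank_prob q n j * mallows q s.
Proof.
rewrite /mallows sum_lift_perm inv_lift_perm.
under [X in _ / X]eq_bigr => i _.
  under eq_bigr => t _ do rewrite inv_lift_perm exprD mulrC.
  rewrite -mulr_sumr; over.
rewrite -mulr_suml sum_expr_rev exprD /rank_prob.
have := mallows_total_gt0 n; set Z := \sum_t _ => Z_gt0.
have := subr1_expr_gt0 n; set x := q ^+ n.+1 => x_lt1; rewrite subr_gt0 in x_lt1.
by field; rewrite ?lt0r_neq0 ?subr_gt0.
Qed.

Lemma rank_prob_ge0 k j : 0 <= rank_prob q k j.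
Proof.
by rewrite !mulr_ge0 ?exprn_ge0 ?invr_ge0 ?subr_ge0 ?exprn_ile1 ?ltW.
Qed.

Lemma rank_probkk k : rank_prob q k k = record_prob q k.
Proof. by rewrite /rank_prob subnn expr0 mul1r. Qed.

Lemma sum_rank_prob k : \sum_(j < k.+1) rank_prob q k j = 1.
Proof.
under eq_bigr => j _ do rewrite /rank_prob -mulrA.
rewrite -mulr_suml sum_expr_rev mulrA divfK ?divff //.
  by rewrite gt_eqF // subr1_expr_gt0.
by rewrite gt_eqF // subr_gt0.
Qed.

Lemma sum_rank_prob_nonrecord k :
  \sum_(j < k.+1 | j != ord_max) rank_prob q k j = 1 - record_prob q k.
Proof. by rewrite -(sum_rank_prob k) [in RHS](bigD1 ord_max) //= rank_probkk addrAC subrr add0r. Qed.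

Lemma prob_lift n (A : pred 'S_n.+1) :
  prob q A = \sum_(j < n.+1) rank_prob q n j * prob q (fun s => A (lift_perm ord_max j s)).
Proof.
rewrite /prob big_mkcond sum_lift_perm; apply: eq_bigr => j _.
rewrite mulr_sumr -big_mkcond /=; apply: eq_bigr => s _; exact: mallows_lift.
Qed.

Lemma prob_ge0 n (A : pred 'S_n) : 0 <= prob q A.
Proof. by apply: sumr_ge0 => s _; exact: mallows_ge0. Qed.

Lemma prob_le n (A B : pred 'S_n) : subpred A B -> prob q A <= prob q B.
Proof.
move=> AB; rewrite /prob [leLHS]big_mkcond [leRHS]big_mkcond /=.
apply: ler_sum => s _; have := AB s.
by case: ifP => [_ -> //|_ _]; case: ifP => // _; exact: mallows_ge0.
Qed.

Lemma prob_predT n : prob q (@predT 'S_n) = 1.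
Proof.
rewrite /prob /mallows -mulr_suml divff // gt_eqF //; exact: mallows_total_gt0.
Qed.

Lemma prob_predIC n (A B : pred 'S_n) :
  prob q (fun s => A s && ~~ B s) = prob q A - prob q (fun s => A s && B s).
Proof. by rewrite /prob [\sum_(s | A s) _](bigID B) /= addrC addrK. Qed.

End MallowsLift.

(** * Behaviour of strategies when one more item is inserted *)

Definition stop (d : strategy) (n : nat) (s : 'S_n) (k : nat) : bool :=
  d (relative_ranks s k.+1).

Definition waiting (d : strategy) (n : nat) (s : 'S_n) : bool :=
  ~~ has (stop d s) (iota 0 n).

(** The length [m] of the scan decides the default: with [m = n - 1] a scan without stop falls on
    the last item, as in [success]; with [m = n] it falls outside ['I_n] and does not win. *)
Definition won (m : nat) (d : strategy) (n : nat) (s : 'S_n) : bool :=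
  [exists j : 'I_n, (nat_of_ord j == find (stop d s) (iota 0 m)) && ((s j).+1 == n)].

(** The first [k <= n] items do not include the new one, and [lift] preserves order; hence earlier
    decisions survive the insertion. *)
Lemma relative_ranks_lift (n k : nat) (j : 'I_n.+1) (s : 'S_n) : (k <= n)%N ->
  relative_ranks (lift_perm ord_max j s) k = relative_ranks s k.
Proof.
move=> le_kn; rewrite /relative_ranks enum_ordSr -cats1.
rewrite takel_cat 1?size_map ?size_enum_ord // -map_take -map_comp.
apply: eq_map => a /=; rewrite widen_ord_lift lift_perm_lift.
rewrite -!sum1_card big_mkcond [RHS]big_mkcond big_ord_recr /=.
rewrite inE /= ltnNge le_kn addn0; apply: eq_bigr => i _.
by rewrite !inE widen_ord_lift lift_perm_lift le_lift lift_max.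
Qed.

Lemma stop_lift (d : strategy) (n k : nat) (j : 'I_n.+1) (s : 'S_n) : (k < n)%N ->
  stop d (lift_perm ord_max j s) k = stop d s k.
Proof. by move=> lt_kn; rewrite /stop relative_ranks_lift. Qed.

Lemma eq_in_stop_lift (d : strategy) (n : nat) (j : 'I_n.+1) (s : 'S_n) :
  {in iota 0 n, stop d (lift_perm ord_max j s) =1 stop d s}.
Proof. by move=> k; rewrite mem_iota => /stop_lift ->. Qed.

Lemma iota0S n : iota 0 n.+1 = rcons (iota 0 n) n.
Proof. by rewrite -addn1 iotaD cats1. Qed.

Lemma waiting_lift (d : strategy) (n : nat) (j : 'I_n.+1) (s : 'S_n) :
  waiting d (lift_perm ord_max j s) =
  waiting d s && ~~ stop d (lift_perm ord_max j s) n.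
Proof.
by rewrite /waiting iota0S has_rcons negb_or andbC (eq_in_has (@eq_in_stop_lift d n j s)).
Qed.

Lemma won_lift_record (m : nat) (d : strategy) (n : nat) (s : 'S_n) :
  won m d (lift_perm ord_max ord_max s) =
  (find (stop d (lift_perm ord_max ord_max s)) (iota 0 m) == n).
Proof.
apply/existsP/idP => [[j /andP[/eqP <-]]|/eqP def_n]; last first.
  by exists ord_max; rewrite def_n lift_perm_id !eqxx.
rewrite eqSS; case: (unliftP ord_max j) => [i|] -> //.
by rewrite lift_perm_lift lift_max ltn_eqF.
Qed.

(** The best item is an earlier one, so a scan that passes time [n - 1] has lost, wherever it
    ends. *)
Lemma won_lift_nonrecord (m : nat) (d : strategy) (n : nat) (j : 'I_n.+1) (s : 'S_n) :
  j != ord_max -> (n <= m)%N ->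
  won m d (lift_perm ord_max j s) = won n d s.
Proof.
move=> j_neq le_nm; set t := lift_perm _ _ _.
have lt_jn : (j < n)%N.
  by rewrite ltn_neqAle -ltnS ltn_ord andbT; apply: contra j_neq => /eqP e; apply/eqP/val_inj.
have find_eq (i : nat) : (i < n)%N ->
    (i == find (stop d t) (iota 0 m)) = (i == find (stop d s) (iota 0 n)).
  move=> lt_in; rewrite -(subnKC le_nm) iotaD find_cat.
  rewrite (eq_in_has (@eq_in_stop_lift d n j s)) (eq_in_find (@eq_in_stop_lift d n j s)).
  case: ifPn => // /hasNfind ->; rewrite size_iota.
  by rewrite !ltn_eqF // ltn_addr.
have rank_eq (i : 'I_n) : ((t (lift ord_max i)).+1 == n.+1) = ((s i).+1 == n).
  rewrite lift_perm_lift /= /bump eqSS; have := ltn_ord (s i); case: leqP => /=; lia.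
apply/existsP/existsP => -[i /andP[/eqP ei si]].
  case: (unliftP ord_max i) => [i' def_i|def_i].
    by exists i'; rewrite -rank_eq -def_i si andbT -find_eq // -ei def_i lift_max.
  move: si; rewrite def_i lift_perm_id eqSS => /eqP ej; by rewrite ej ltnn in lt_jn.
exists (lift ord_max i); rewrite rank_eq si andbT lift_max find_eq //.
exact/eqP.
Qed.

Definition rrank (n : nat) (s : 'S_n) (k : nat) (a : 'I_n) : nat :=
  #|[set i : 'I_n | (i < k)%N && (s i <= s a)%N]|%SET.

(** The sets counted are nested in the order of the ranks; [b] belongs to its own set, as [b < k],
    and makes the inclusion strict. *)
Lemma lt_rrank (n : nat) (s : 'S_n) (k : nat) (a b : 'I_n) : (b < k)%N ->
  (rrank s k a < rrank s k b)%N = (s a < s b)%N.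
Proof.
move=> lt_bk; rewrite /rrank; case: (ltnP (s a)) => [lt_ab|le_ba].
  apply/proper_card/properP; split; first apply/fintype.subsetP => i.
    by rewrite !inE => /andP[-> /leq_trans->] //; exact: ltnW.
  by exists b; rewrite !inE ?lt_bk //= -ltnNge.
apply: negbTE; rewrite -leqNgt; apply/subset_leq_card/fintype.subsetP => i.
by rewrite !inE => /andP[-> /leq_trans->].
Qed.

Lemma stop_threshold (n M : nat) (s : 'S_n) (i : 'I_n) :
  stop (threshold M) s i = (M <= i)%N && [forall (a : 'I_n | (a < M)%N), (s a < s i)%N].
Proof.
rewrite /stop /threshold.
have -> : relative_ranks s i.+1 = map (rrank s i.+1) (take i.+1 (enum 'I_n)) by [].
rewrite size_map size_takel ?size_enum_ord // ltnS; case: leqP => //= le_Mi.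
rewrite -map_take take_takel ?leqW // (take_nth i) ?size_enum_ord // nth_ord_enum.
rewrite map_rcons last_rcons all_map.
apply/allP/forall_inP => [lt_i a lt_aM|lt_i a].
  rewrite -(@lt_rrank _ _ i.+1) //; apply: lt_i.
  by rewrite in_take ?mem_enum // index_enum_ord.
rewrite in_take ?mem_enum // index_enum_ord => /lt_i /=.
by rewrite lt_rrank.
Qed.

(* As long as S(n,M) has rejected everything, the best item so far is among the
   first M, so the strategy stops exactly on the next record. *)
Lemma stop_threshold_waiting (k M : nat) (j : 'I_k.+1) (s : 'S_k) : (M <= k)%N ->
  waiting (threshold M) s ->
  stop (threshold M) (lift_perm ord_max j s) k = (j == ord_max).
Proof.
move=> le_Mk wait; set t := lift_perm _ _ _.
rewrite (@stop_threshold _ _ _ ord_max) le_Mk /= lift_perm_id.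
apply/forall_inP/eqP => [best_M|def_j a lt_aM].
  apply/eqP; apply: contraT => j_neq.
  have lt_jk : (j < k)%N.
    by rewrite ltn_neqAle -ltnS ltn_ord andbT; apply: contra j_neq => /eqP e; apply/eqP/val_inj.
  have k_gt0 : (0 < k)%N by exact: leq_trans lt_jk.
  (* [i0] is the best of the first [k] items. It is not among the first [M], which the current
     non-record beats, so the strategy would have stopped at it, contradicting [waiting]. *)
  have [i0 def_i0] : exists i0 : 'I_k, s i0 = k.-1 :> nat.
    have lt_k : (k.-1 < k)%N by rewrite prednK.
    by exists (s^-1%g (Ordinal lt_k)); rewrite permKV.
  have t_i0 : (j < t (lift ord_max i0))%N.
    by rewrite lift_perm_lift /= /bump def_i0; case: leqP => /=; lia.
  have le_Mi0 : (M <= i0)%N.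
    rewrite leqNgt; apply/negP => lt_i0M.
    have lt_i0 : (t (lift ord_max i0) < j)%N by apply: best_M; rewrite lift_max.
    by have := ltn_trans lt_i0 t_i0; rewrite ltnn.
  case/negP: wait; apply/hasP; exists (i0 : nat); first by rewrite mem_iota leq0n add0n ltn_ord.
  rewrite stop_threshold le_Mi0; apply/forall_inP => a lt_aM.
  rewrite ltn_neqAle def_i0 -ltnS prednK // ltn_ord andbT.
  apply: contraTneq lt_aM => e; have -> : a = i0; last by rewrite -leqNgt.
  by apply: (@perm_inj _ s); apply: ord_inj; rewrite e def_i0.
case: (unliftP ord_max a) lt_aM => [b|] ->; last by rewrite ltnNge le_Mk.
by move=> _; rewrite lift_perm_lift def_j lift_max ltn_ord.
Qed.

(** * Independent records: no record, exactly one record, and the sum of the odds *)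

Section Odds.
Variables (R : realType) (p : nat -> R).
Hypothesis p_gt0 : forall k, 0 < p k.
Hypothesis p_lt1 : forall k, p k.+1 < 1.
Hypothesis p0 : p 0 = 1.

Definition no_record (n M : nat) : R := \prod_(M <= j < n) (1 - p j).

(** The term [j = 0] has denominator 0, because [p 0 = 1], and counts as 0; hence the hypothesis
    [0 < M] in the comparisons below. *)
Definition odds (n M : nat) : R := \sum_(M <= j < n) p j / (1 - p j).

(** The summand is the probability that [j] is the only record time from [M] on. *)
Definition one_record (n M : nat) : R :=
  \sum_(M <= j < n) no_record j M * p j * no_record n j.+1.

Lemma no_record_recr n M : (M <= n)%N -> no_record n.+1 M = no_record n M * (1 - p n).
Proof. by move=> le_Mn; rewrite /no_record big_nat_recr. Qed.

Lemma no_record_recl n M : (M < n)%N -> no_record n M = (1 - p M) * no_record n M.+1.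
Proof. by move=> lt_Mn; rewrite /no_record big_ltn. Qed.

Lemma no_record_nn n : no_record n n = 1.
Proof. by rewrite /no_record big_geq. Qed.

Lemma one_record_nn n : one_record n n = 0.
Proof. by rewrite /one_record big_geq. Qed.

Lemma one_record_recr n M : (M <= n)%N ->
  one_record n.+1 M = (1 - p n) * one_record n M + p n * no_record n M.
Proof.
move=> le_Mn; rewrite /one_record big_nat_recr //= no_record_nn mulr1; congr (_ + _).
  rewrite mulr_sumr; apply: eq_big_nat => j /andP[_ lt_jn].
  by rewrite no_record_recr // mulrA mulrC.
by rewrite mulrC.
Qed.

Lemma one_record_recl n M : (M < n)%N ->
  one_record n M = p M * no_record n M.+1 + (1 - p M) * one_record n M.+1.
Proof.
move=> lt_Mn; rewrite /one_record big_ltn // no_record_nn mul1r mulr_sumr; congr (_ + _).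
by apply: eq_big_nat => j /andP[lt_Mj _]; rewrite (@no_record_recl j) // !mulrA.
Qed.

Lemma onem_gt0 k : (0 < k)%N -> 0 < 1 - p k.
Proof. by case: k => // k _; rewrite subr_gt0. Qed.

Lemma onem_ge0 k : 0 <= 1 - p k.
Proof. by case: k => [|k]; rewrite ?p0 ?subrr // ltW // onem_gt0. Qed.

Lemma no_record_ge0 n M : 0 <= no_record n M.
Proof. by apply: prodr_ge0 => j _; exact: onem_ge0. Qed.

Lemma no_record_gt0 n M : (0 < M)%N -> 0 < no_record n M.
Proof.
move=> M_gt0; rewrite /no_record big_nat_cond prodr_gt0 // => j /andP[/andP[le_Mj _] _].
by rewrite onem_gt0 // (leq_trans M_gt0).
Qed.

Lemma one_record_ge0 n M : 0 <= one_record n M.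
Proof. by apply: sumr_ge0 => j _; rewrite !mulr_ge0 ?no_record_ge0 // ltW. Qed.

Lemma odds_recl n M : (M < n)%N -> odds n M = p M / (1 - p M) + odds n M.+1.
Proof. by move=> lt_Mn; rewrite /odds big_ltn. Qed.

Lemma odds_lt n M K : (0 < M)%N -> (M < K <= n)%N -> odds n K < odds n M.
Proof.
move=> M_gt0 /andP[lt_MK le_Kn].
rewrite /odds [ltRHS](big_cat_nat (n := K)) //= ?(ltnW lt_MK) //.
rewrite ltrDr big_ltn // ltr_pwDl ?divr_gt0 ?onem_gt0 //.
apply: sumr_ge0 => j _; rewrite divr_ge0 ?onem_ge0 //; exact: ltW.
Qed.

Lemma odds_le n M K : (0 < M)%N -> (M <= K <= n)%N -> odds n K <= odds n M.
Proof.
move=> M_gt0 /andP[]; rewrite leq_eqVlt => /predU1P[<- //|lt_MK le_Kn].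
by apply/ltW/odds_lt; rewrite ?lt_MK.
Qed.

(** Each term of [one_record] is the product [no_record n M] with one factor [1 - p j] replaced by
    [p j]. *)
Lemma one_record_odds n M : (0 < M)%N -> one_record n M = no_record n M * odds n M.
Proof.
move=> M_gt0; have [le_Mn|lt_nM] := leqP M n; last first.
  by rewrite /one_record /odds !big_geq ?mulr0 // ltnW.
elim: n le_Mn => [|n IH]; first by rewrite leqNgt M_gt0.
rewrite leq_eqVlt => /predU1P[<-|]; first by rewrite one_record_nn /odds big_geq ?mulr0.
rewrite ltnS => le_Mn; rewrite one_record_recr // IH // no_record_recr //.
rewrite /odds big_nat_recr //=.
have := onem_gt0 (leq_trans M_gt0 le_Mn); set u := 1 - p n => u_gt0.
by field; rewrite gt_eqF.
Qed.

Lemma no_record_anti n k M : (k <= M)%N -> (M <= n)%N -> no_record n k <= no_record n M.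
Proof.
move=> le_kM le_Mn; rewrite /no_record (big_cat_nat (n := M)) //=.
rewrite ler_piMl ?no_record_ge0 //.
by apply: prodr_ile1 => j; rewrite onem_ge0 gerBl ltW.
Qed.

End Odds.

(** * Dynamic programming and the odds theorem *)

Section Optimality.
Variables (R : realType) (q : R).
Hypothesis q01 : 0 < q < 1.
Local Notation p := (record_prob q).

Let q_gt0 : 0 < q. Proof. by case/andP: q01. Qed.
Let q_lt1 : q < 1. Proof. by case/andP: q01. Qed.

Lemma record_prob_gt0 k : 0 < p k.
Proof. by rewrite divr_gt0 ?subr1_expr_gt0 ?subr_gt0. Qed.

Lemma record_prob_lt1 k : p k.+1 < 1.
Proof.
rewrite ltr_pdivrMr ?subr1_expr_gt0 // mul1r ltrD2l ltrN2 exprS.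
by rewrite gtr_pMr // exprn_ilt1 // ltW.
Qed.

Lemma record_prob0 : p 0 = 1.
Proof. by rewrite /record_prob expr1 divff // subr_eq0 gt_eqF. Qed.

Let p_gt0 := record_prob_gt0.
Let p_lt1 := record_prob_lt1.
Let p0 := record_prob0.

(** An event on the first [n] items only: the strategy is still waiting and would accept the next
    item if that were a record. *)
Definition record_stop (d : strategy) (n : nat) (s : 'S_n) : bool :=
  waiting d s && stop d (lift_perm ord_max ord_max s) n.

(** The two states of the dynamic programme after [n] items: [a] for having selected the best one so
    far, [b] for having selected none. *)
Let a (d : strategy) n := prob q (@won n d n).
Let b (d : strategy) n := prob q (@waiting d n).

Lemma prob_lift_won (m : nat) (d : strategy) (n : nat) : (n <= m)%N ->
  prob q (@won m d n.+1) = (1 - p n) * prob q (@won n d n) +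
    p n * prob q (fun s : 'S_n => find (stop d (lift_perm ord_max ord_max s)) (iota 0 m) == n).
Proof.
move=> le_nm; rewrite (prob_lift q01) (bigD1 ord_max) //= rank_probkk addrC; congr (_ + _ * _).
  rewrite -(sum_rank_prob_nonrecord q01) mulr_suml; apply: eq_bigr => j j_neq.
  by congr (_ * _); apply: eq_bigl => s; rewrite won_lift_nonrecord.
by apply: eq_bigl => s; rewrite won_lift_record.
Qed.

(** As the last item must be accepted, a record at the last time wins whenever the strategy is still
    waiting, whatever it answers. *)
Lemma prob_success (d : strategy) (n : nat) :
  success_prob n.+1 q d = (1 - p n) * a d n + p n * b d n.
Proof.
rewrite -[LHS]/(prob q (@won n d n.+1)) prob_lift_won //; congr (_ + _ * _).
apply: eq_bigl => s; rewrite (eq_in_find (@eq_in_stop_lift d n ord_max s)).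
rewrite /waiting has_find size_iota -leqNgt eqn_leq.
by rewrite -[X in (_ <= X)%N](size_iota 0 n) find_size.
Qed.

Lemma prob_wonS (d : strategy) (n : nat) :
  a d n.+1 = (1 - p n) * a d n + p n * prob q (@record_stop d n).
Proof.
rewrite /a prob_lift_won //; congr (_ + _ * _); apply: eq_bigl => s.
rewrite iota0S -cats1 find_cat (eq_in_has (@eq_in_stop_lift d n ord_max s)).
rewrite (eq_in_find (@eq_in_stop_lift d n ord_max s)) /record_stop /waiting.
case: ifPn => [|_] /=; first by rewrite has_find size_iota => /ltn_eqF.
by case: ifP => _; rewrite size_iota ?addn0 ?eqxx // addn1 gtn_eqF.
Qed.

(** Only the stops at records are subtracted; stops at non-records lower the left side further,
    whence an inequality. *)
Lemma prob_waitingS (d : strategy) (n : nat) :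
  b d n.+1 <= b d n - p n * prob q (@record_stop d n).
Proof.
rewrite /b (prob_lift q01) (bigD1 ord_max) //= rank_probkk.
have -> : prob q (fun s : 'S_n => waiting d (lift_perm ord_max ord_max s)) =
          b d n - prob q (@record_stop d n).
  rewrite -prob_predIC; apply: eq_bigl => s; exact: waiting_lift.
have le_nonrec : \sum_(j < n.+1 | j != ord_max) rank_prob q n j *
    prob q (fun s : 'S_n => waiting d (lift_perm ord_max j s)) <= (1 - p n) * b d n.
  rewrite -(sum_rank_prob_nonrecord q01) mulr_suml; apply: ler_sum => j _.
  rewrite ler_wpM2l ?rank_prob_ge0 // prob_le // => s.
  by rewrite /= waiting_lift => /andP[].
by rewrite /b in le_nonrec *; lra.
Qed.

Lemma prob_won0 d : a d 0 = 0.
Proof. by rewrite /a /prob big_pred0 // => s; apply/existsP => -[[]]. Qed.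

Lemma prob_waiting0 d : b d 0 = 1.
Proof. by rewrite /b -(prob_predT q01 0). Qed.

Lemma record_stop_le d n : prob q (@record_stop d n) <= b d n.
Proof. by apply: prob_le => // s /andP[]. Qed.

(* Dynamic programming: [v k] dominates the value of being still waiting before
   the item of time k, and [no_record p n k] is the value of having already
   selected the best of the first k items. *)
Lemma success_prob_le (d : strategy) (n : nat) (v : nat -> R) : (forall k, 0 <= v k) ->
  (forall k, (k < n.+1)%N -> v k.+1 <= v k) ->
  (forall k, (k < n.+1)%N -> p k * no_record p n.+1 k.+1 + (1 - p k) * v k.+1 <= v k) ->
  success_prob n.+1 q d <= v 0.
Proof.
move=> v_ge0 v_anti v_rec.
(* The left side does not increase with [k], and equals [v 0] at [k = 0]. *)
have dp k : (k <= n)%N -> a d k * no_record p n.+1 k + b d k * v k <= v 0.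
  elim: k => [|k IH lt_kn]; first by rewrite prob_won0 prob_waiting0; lra.
  apply: le_trans (IH (ltnW lt_kn)).
  rewrite prob_wonS (no_record_recl p (leqW lt_kn)).
  have := ler_wpM2r (v_ge0 k.+1) (prob_waitingS d k).
  (* The mass [b d k] is split into [record_stop], bounded by [v_rec], and the rest, bounded by
     [v_anti]. *)
  have le_b := record_stop_le d k; rewrite -subr_ge0 in le_b.
  have := ler_wpM2l le_b (v_anti k (leqW lt_kn)).
  have := ler_wpM2l (prob_ge0 q01 (@record_stop d k)) (v_rec k (leqW lt_kn)).
  lra.
apply: le_trans (dp n (leqnn n)); rewrite prob_success.
rewrite no_record_recl // no_record_nn mulr1 mulrC lerD2l mulrC.
rewrite ler_wpM2l ?prob_ge0 //.
have := v_rec n (ltnSn n); rewrite no_record_nn.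
by have := mulr_ge0 (onem_ge0 p_lt1 p0 n) (v_ge0 n.+1); lra.
Qed.

Lemma waiting_threshold M k (s : 'S_k) : (k <= M)%N -> waiting (threshold M) s.
Proof.
move=> le_kM; apply/hasPn => i; rewrite mem_iota add0n => lt_ik.
by rewrite (@stop_threshold _ _ _ (Ordinal lt_ik)) /= leqNgt (leq_trans lt_ik).
Qed.

Lemma prob_waiting_threshold_before M k : (k <= M)%N -> b (threshold M) k = 1.
Proof.
move=> le_kM; rewrite /b -(prob_predT q01 k); apply: eq_bigl => s.
by rewrite waiting_threshold.
Qed.

Lemma prob_won_threshold_before M k : (k <= M)%N -> a (threshold M) k = 0.
Proof.
elim: k => [|k IH lt_kM]; first by rewrite prob_won0.
have -> : a (threshold M) k.+1 = (1 - p k) * 0 + p k * 0; last by rewrite !mulr0 addr0.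
rewrite prob_wonS IH ?(ltnW lt_kM) //; congr (_ + _ * _); apply: big_pred0 => s.
by rewrite /record_stop (@stop_threshold _ _ _ ord_max) /= leqNgt lt_kM andbF.
Qed.

Lemma record_stop_threshold M k (s : 'S_k) : (M <= k)%N ->
  record_stop (threshold M) s = waiting (threshold M) s.
Proof.
rewrite /record_stop => le_Mk; case wait: waiting => //=.
by rewrite stop_threshold_waiting ?eqxx.
Qed.

Lemma prob_waiting_threshold M k : (M <= k)%N -> b (threshold M) k = no_record p k M.
Proof.
elim: k => [|k IH]; first by rewrite leqn0 => /eqP->; rewrite prob_waiting0 no_record_nn.
rewrite leq_eqVlt => /predU1P[<-|]; first by rewrite prob_waiting_threshold_before // no_record_nn.
rewrite ltnS => le_Mk; rewrite no_record_recr // -IH // mulrC.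
rewrite /b (prob_lift q01) (bigD1 ord_max) //=.
have -> : prob q (fun s : 'S_k => waiting (threshold M) (lift_perm ord_max ord_max s)) = 0.
  apply: big_pred0 => s; rewrite waiting_lift; case wait: (waiting _ s) => //=.
  by rewrite stop_threshold_waiting ?eqxx.
rewrite mulr0 add0r.
rewrite -(sum_rank_prob_nonrecord q01) mulr_suml; apply: eq_bigr => j j_neq.
congr (_ * _); apply: eq_bigl => s; rewrite waiting_lift.
by case wait: (waiting _ s) => //=; rewrite stop_threshold_waiting // (negbTE j_neq).
Qed.

(** The strategy takes the first record from time [M] on; it holds the best item exactly when no
    other record follows. *)
Lemma prob_won_threshold M k : (M <= k)%N -> a (threshold M) k = one_record p k M.
Proof.
elim: k => [|k IH]; first by rewrite leqn0 => /eqP->; rewrite prob_won0 one_record_nn.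
rewrite leq_eqVlt => /predU1P[<-|]; first by rewrite prob_won_threshold_before // one_record_nn.
rewrite ltnS => le_Mk; rewrite one_record_recr // prob_wonS IH // -prob_waiting_threshold //.
congr (_ + _ * _); apply: eq_bigl => s; exact: record_stop_threshold.
Qed.

Lemma success_prob_threshold n M : (M < n)%N ->
  success_prob n q (threshold M) = one_record p n M.
Proof.
case: n => // n; rewrite ltnS => le_Mn.
by rewrite prob_success prob_won_threshold // prob_waiting_threshold // -one_record_recr.
Qed.

(* The odds theorem: stop at the first record from the time when the remaining
   odds fall to 1. *)
Lemma optimal_threshold n M : (M < n)%N ->
  optimal n q (threshold M) <->
  odds p n M.+1 <= 1 /\ ((0 < M)%N -> 1 <= odds p n M).
Proof.
move=> lt_Mn; split=> [opt|[odds_le1 odds_ge1]].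
  split.
    have [lt_M1n|le_nM1] := ltnP M.+1 n; last by rewrite /odds big_geq.
    (* Necessity compares neighbouring thresholds: passing from [M.+1] to [M] changes the success
       probability by [p M * no_record p n M.+1 * (1 - odds p n M.+1)]. *)
    have := opt (threshold M.+1); rewrite !success_prob_threshold //.
    rewrite (one_record_recl p lt_Mn) (one_record_odds p_lt1) //.
    have := p_gt0 M; have := no_record_gt0 p_lt1 n (ltn0Sn M).
    set u := odds _ _ _; set N := no_record _ _ _; set x := p M => N_gt0 x_gt0 le_u.
    have : 0 <= (x * N) * (1 - u) by lra.
    by rewrite (pmulr_rge0 _ (mulr_gt0 x_gt0 N_gt0)) subr_ge0.
  case: M lt_Mn opt => // m lt_mn opt _.
  have := opt (threshold m); rewrite !success_prob_threshold ?(ltnW lt_mn) //.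
  rewrite (one_record_recl p (ltnW lt_mn)) (one_record_odds p_lt1) //.
  have := p_gt0 m; have := no_record_gt0 p_lt1 n (ltn0Sn m).
  set u := odds _ _ _; set N := no_record _ _ _; set x := p m => N_gt0 x_gt0 le_u.
  have : 0 <= (x * N) * (u - 1) by lra.
  by rewrite (pmulr_rge0 _ (mulr_gt0 x_gt0 N_gt0)) subr_ge0.
move=> d; case: n lt_Mn odds_le1 odds_ge1 => // n lt_Mn odds_le1 odds_ge1.
(* Value of waiting at time [k] under the threshold strategy; it is constant up to time [M]. *)
pose v k := one_record p n.+1 (maxn k M).
rewrite success_prob_threshold // -[M in leRHS]max0n -[leRHS]/(v 0).
(* From [M] on the remaining odds are at most 1, so holding the best item is worth at least as much
   as waiting; before [M], [le_k] below gives the reverse. *)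
have small k : (M <= k)%N -> (k <= n)%N -> one_record p n.+1 k.+1 <= no_record p n.+1 k.+1.
  move=> le_Mk le_kn; rewrite (one_record_odds p_lt1) // ler_piMr ?no_record_ge0 //.
  by apply: le_trans odds_le1; apply: odds_le; rewrite // !ltnS le_Mk.
apply: success_prob_le => [k|k lt_kn|k lt_kn].
- exact: one_record_ge0.
- rewrite /v; have [lt_kM|le_Mk] := ltnP k M; first by rewrite (maxn_idPr lt_kM).
  rewrite (maxn_idPl (leqW le_Mk)) (one_record_recl p lt_kn).
  have le_k := small k le_Mk lt_kn; rewrite -subr_ge0 in le_k.
  by have := mulr_ge0 (ltW (p_gt0 k)) le_k; lra.
rewrite /v; have [lt_kM|le_Mk] := ltnP k M; last first.
  by rewrite (maxn_idPl (leqW le_Mk)) (one_record_recl p lt_kn).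
rewrite (maxn_idPr lt_kM).
have M_gt0 : (0 < M)%N by exact: leq_trans lt_kM.
have le_k : no_record p n.+1 k.+1 <= one_record p n.+1 M.
  apply: (le_trans (no_record_anti p_gt0 p_lt1 p0 lt_kM (ltnW lt_Mn))).
  by rewrite (one_record_odds p_lt1) // ler_peMr ?no_record_ge0 // odds_ge1.
by rewrite -subr_ge0 in le_k; have := mulr_ge0 (ltW (p_gt0 k)) le_k; lra.
Qed.

(** The least [M] with [odds p n M.+1 <= 1] works: if [0 < M], minimality makes [odds p n M] exceed
    1. *)
Lemma ex_optimal_threshold n : (0 < n)%N ->
  exists2 M, (M < n)%N & optimal n q (threshold M).
Proof.
move=> n_gt0.
have ex_M : exists M, odds p n M.+1 <= 1 by exists n.-1; rewrite prednK // /odds big_geq.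
case: (ex_minnP ex_M) => M odds_le1 M_min; have lt_Mn : (M < n)%N.
  by rewrite -(prednK n_gt0) ltnS M_min // prednK // /odds big_geq.
exists M => //; apply/optimal_threshold => //; split=> //.
case: M {odds_le1 lt_Mn} M_min => // m M_min _.
by rewrite leNgt; apply/negP => /ltW/M_min; rewrite ltnn.
Qed.

Lemma optimal_value_eq n (d : strategy) : optimal n q d ->
  optimal_value n q = success_prob n q d.
Proof.
move=> opt; apply/eqP; rewrite eq_le; apply/andP; split.
  by apply: ge_sup => [|_ [d' _ <-]]; [exists (success_prob n q d); exists d | exact: opt].
apply: ub_le_sup; last by exists d.
by exists (success_prob n q d) => _ [d' _ <-]; exact: opt.
Qed.

End Optimality.

(** * Telescoping form of the odds and logarithmic bounds *)

Section LogBounds.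
Variables (R : realType) (q : R).
Hypothesis q01 : 0 < q < 1.
Local Notation p := (record_prob q).

Let q_gt0 : 0 < q. Proof. by case/andP: q01. Qed.
Let q_lt1 : q < 1. Proof. by case/andP: q01. Qed.

(** For [0 < k], [1 - p k = invpow k / invpow k.+1], so that products of these factors telescope. *)
Definition invpow (k : nat) : R := q^-1 ^+ k - 1.

Lemma invpowS k : invpow k.+1 = q^-1 * invpow k + (q^-1 - 1).
Proof. by rewrite /invpow exprS; ring. Qed.

Lemma invpow_homo j k : (j <= k)%N -> invpow j <= invpow k.
Proof. by move=> le_jk; rewrite lerD2r ler_weXn2l // ltW // invf_gt1. Qed.

Lemma invpow_gt0 k : (0 < k)%N -> 0 < invpow k.
Proof. by move=> k_gt0; rewrite subr_gt0 exprn_egt1 ?invf_gt1 // -lt0n. Qed.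

(** A Bernoulli bound; it keeps [invpow n] away from 0 as long as [n * (1 - q)] is. *)
Lemma invpow_ge k : k%:R * (1 - q) <= invpow k.
Proof.
elim: k => [|k IH]; first by rewrite mul0r /invpow expr0 subrr.
have w_gt1 : 1 < q^-1 by rewrite invf_gt1.
rewrite invpowS -natr1 mulrDl mul1r lerD //.
  apply: (le_trans IH); rewrite ler_peMl ?(ltW w_gt1) //; apply: le_trans IH.
  by rewrite mulr_ge0 // subr_ge0 ltW.
have -> : q^-1 - 1 = q^-1 * (1 - q) by field; rewrite gt_eqF.
by rewrite ler_peMl ?subr_ge0 ?(ltW w_gt1) ?(ltW q_lt1).
Qed.

Definition invpow_ratio (k : nat) : R := invpow k.+1 / invpow k.

(** In this form the ratio visibly decreases in [k] towards [q^-1]. *)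
Lemma invpow_ratioE k : (0 < k)%N -> invpow_ratio k = q^-1 + (q^-1 - 1) / invpow k.
Proof.
by move=> /invpow_gt0 y_gt0; rewrite /invpow_ratio invpowS; field; rewrite !gt_eqF.
Qed.

Lemma invpow_ratio_ge1 k : (0 < k)%N -> 1 <= invpow_ratio k.
Proof.
by move=> k_gt0; rewrite ler_pdivlMr ?invpow_gt0 // mul1r invpow_homo.
Qed.

Lemma invpow_ratio_anti j k : (0 < j)%N -> (j <= k)%N -> invpow_ratio k <= invpow_ratio j.
Proof.
move=> j_gt0 le_jk; have k_gt0 := leq_trans j_gt0 le_jk.
rewrite !invpow_ratioE // lerD2l ler_wpM2l //.
  by rewrite subr_ge0 ltW // invf_gt1.
by rewrite lef_pV2 ?posrE ?invpow_gt0 // invpow_homo.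
Qed.

Lemma record_prob_invpow k : (0 < k)%N -> 1 - p k = invpow k / invpow k.+1.
Proof.
move=> k_gt0; have := subr1_expr_gt0 q01 k.
rewrite /record_prob /invpow !exprVn !exprS; have := exprn_gt0 k q_gt0.
set x := q ^+ k => x_gt0; rewrite subr_gt0 => xq_lt1.
by field; rewrite mulN1r !gt_eqF ?subr_gt0.
Qed.

Lemma odds_invpow n M : (0 < M)%N ->
  odds p n M = \sum_(M <= j < n) (invpow_ratio j - 1).
Proof.
move=> M_gt0; apply: eq_big_nat => j /andP[le_Mj _].
have j_gt0 := leq_trans M_gt0 le_Mj; rewrite record_prob_invpow //.
have -> : p j = 1 - invpow j / invpow j.+1 by rewrite -record_prob_invpow //; ring.
rewrite /invpow_ratio; have := invpow_gt0 j_gt0; have := invpow_gt0 (ltn0Sn j).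
set x := invpow j.+1; set y := invpow j => x_gt0 y_gt0.
by field; rewrite !gt_eqF.
Qed.

Lemma no_record_invpow n M : (0 < M)%N -> (M <= n)%N ->
  no_record p n M = invpow M / invpow n.
Proof.
move=> M_gt0; elim: n => [|n IH]; first by rewrite leqNgt M_gt0.
rewrite leq_eqVlt => /predU1P[<-|]; first by rewrite no_record_nn divff // gt_eqF // invpow_gt0.
rewrite ltnS => le_Mn; rewrite no_record_recr // IH // record_prob_invpow ?(leq_trans M_gt0) //.
have := invpow_gt0 (leq_trans M_gt0 le_Mn); have := invpow_gt0 (ltn0Sn n).
set x := invpow n.+1; set y := invpow n => x_gt0 y_gt0.
by field; rewrite !gt_eqF.
Qed.

Lemma sum_ln_invpow_ratio n M : (0 < M)%N -> (M <= n)%N ->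
  \sum_(M <= j < n) ln (invpow_ratio j) = ln (invpow n / invpow M).
Proof.
move=> M_gt0 le_Mn; rewrite ln_div ?posrE ?invpow_gt0 ?(leq_trans M_gt0) //.
rewrite -(telescope_sumr (fun k => ln (invpow k))) //.
apply: eq_big_nat => j /andP[le_Mj _].
by rewrite ln_div ?posrE ?invpow_gt0 // (leq_trans M_gt0).
Qed.

(* Both bounds compare the sum of [t - 1] with the telescoping sum of [ln t],
   for [t = invpow_ratio j] decreasing in [j], by [ln t <= t - 1 <= t * ln t]. *)
Lemma odds_ge_ln n M : (0 < M)%N -> (M <= n)%N ->
  ln (invpow n / invpow M) <= odds p n M.
Proof.
move=> M_gt0 le_Mn; rewrite -sum_ln_invpow_ratio // odds_invpow //.
apply: ler_sum_nat => j /andP[le_Mj _].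
have t_ge1 := invpow_ratio_ge1 (leq_trans M_gt0 le_Mj).
have /le_ln1Dx : -1 < invpow_ratio j - 1 by lra.
by rewrite [1 + _]addrC subrK.
Qed.

Lemma odds_le_ln n M : (0 < M)%N -> (M <= n)%N ->
  odds p n M <= invpow_ratio M * ln (invpow n / invpow M).
Proof.
move=> M_gt0 le_Mn; rewrite -sum_ln_invpow_ratio // odds_invpow // mulr_sumr.
apply: ler_sum_nat => j /andP[le_Mj _].
have t_ge1 := invpow_ratio_ge1 (leq_trans M_gt0 le_Mj).
have le_t := invpow_ratio_anti M_gt0 le_Mj.
set t := invpow_ratio j in t_ge1 le_t *.
have t_gt0 : 0 < t by lra.
apply: (@le_trans _ _ (t * ln t)); last by rewrite ler_wpM2r // ln_ge0.
(* The bound [t - 1 <= t * ln t] is [ln x <= x - 1] at [x = t^-1]. *)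
have tV_gt0 : 0 < t^-1 by rewrite invr_gt0.
have /le_ln1Dx : -1 < t^-1 - 1 by lra.
rewrite [1 + _]addrC subrK lnV ?posrE // => le_lnt.
have -> : t - 1 = t * (1 - t^-1) by field; rewrite gt_eqF.
by rewrite ler_wpM2l ?(ltW t_gt0) //; lra.
Qed.

Lemma success_prob_odds n M : (0 < M < n)%N ->
  success_prob n q (threshold M) = invpow M / invpow n * odds p n M.
Proof.
move=> /andP[M_gt0 lt_Mn]; rewrite success_prob_threshold // (one_record_odds (record_prob_lt1 q01)) //.
by rewrite no_record_invpow // ltnW.
Qed.

End LogBounds.

(** * Explicit bounds for one value of [q], sharp as [q] tends to 1 *)

Section Squeeze.
Variables (R : realType) (q : R).
Hypothesis q01 : 0 < q < 1.
Local Notation e := (expR (1 : R)).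

Let q_gt0 : 0 < q. Proof. by case/andP: q01. Qed.
Let q_lt1 : q < 1. Proof. by case/andP: q01. Qed.

Lemma invpow_gt0_index k : 0 < invpow q k -> (0 < k)%N.
Proof. by case: k => //; rewrite /invpow expr0 subrr ltxx. Qed.

Lemma invpow_ratio_le k (delta : R) : 0 < delta -> delta <= invpow q k ->
  invpow_ratio q k <= q^-1 + (q^-1 - 1) / delta.
Proof.
move=> delta_gt0 le_delta; have y_gt0 := lt_le_trans delta_gt0 le_delta.
rewrite invpow_ratioE ?invpow_gt0_index // lerD2l ler_wpM2l //.
  by rewrite subr_ge0 ltW // invf_gt1.
by rewrite lef_pV2 ?posrE.
Qed.

(** Through the logarithmic bounds, [odds p n M.+1 <= 1] bounds [invpow q M.+1] from below and
    [1 <= odds p n M] bounds [invpow q M] from above. [T] dominates [invpow_ratio q M]; it tends to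
    1 with [q], and then both ends tend to [1/e]. *)
Lemma optimal_invpow_bounds n M (c0 : R) (T := q^-1 + (q^-1 - 1) / (c0 / (4 * e))) :
  (M < n)%N -> optimal n q (threshold M) -> 0 < c0 -> c0 <= n%:R * (1 - q) ->
  q^-1 <= 2 -> q^-1 - 1 <= c0 / (2 * e) ->
  (e * T)^-1 <= invpow q M / invpow q n <= expR (- T^-1).
Proof.
move=> lt_Mn /(optimal_threshold q01 lt_Mn)[odds_le1 odds_ge1] c0_gt0 c0_le w_le2 w_le.
have e_gt0 : 0 < e by exact: expR_gt0.
have w_gt1 : 1 < q^-1 by rewrite invf_gt1.
have yn_gt0 : 0 < invpow q n by apply: invpow_gt0; rewrite // (leq_trans _ lt_Mn).
have yM1_gt0 : 0 < invpow q M.+1 by apply: invpow_gt0.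
have ge_yM1 : invpow q n / e <= invpow q M.+1.
  rewrite ler_pdivrMr // mulrC -ler_pdivrMr //.
  rewrite -ler_ln ?posrE ?divr_gt0 // expRK.
  by apply: le_trans odds_le1; apply: odds_ge_ln.
have delta_gt0 : 0 < c0 / (4 * e) by rewrite divr_gt0 // mulr_gt0.
(* From [invpow q M.+1 >= c0 / e], the recurrence [invpowS] loses at most [c0 / (2 * e)] by its
   constant term and a factor at most 2 by [q^-1]. In particular [M] is not 0. *)
have ge_yM : c0 / (4 * e) <= invpow q M.
  have : c0 / e <= invpow q n / e.
    by rewrite ler_pM2r ?invr_gt0 // (le_trans c0_le) // invpow_ge.
  move=> /le_trans/(_ ge_yM1); rewrite invpowS => le1.
  have E1 : c0 / (4 * e) = c0 / e / 4 by field; rewrite gt_eqF.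
  have E2 : c0 / (2 * e) = c0 / e / 2 by field; rewrite gt_eqF.
  have le2 : c0 / e / 2 <= q^-1 * invpow q M by lra.
  have yM_ge0 : 0 <= invpow q M.
    by rewrite -[leLHS](subrr 1) -[X in X - _](expr0 q^-1) invpow_homo.
  by have := ler_wpM2r yM_ge0 w_le2; rewrite E1; lra.
have yM_gt0 := lt_le_trans delta_gt0 ge_yM.
have M_gt0 := invpow_gt0_index yM_gt0.
have ratio_le := invpow_ratio_le delta_gt0 ge_yM; rewrite -/T in ratio_le.
have T_ge1 := le_trans (invpow_ratio_ge1 q01 M_gt0) ratio_le.
have T_gt0 : 0 < T by lra.
apply/andP; split.
  rewrite ler_pdivlMr // mulrC ler_pdivrMr ?mulr_gt0 //.
  have le_yM1 : invpow q M.+1 <= T * invpow q M by rewrite -ler_pdivrMr.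
  rewrite ler_pdivrMr // in ge_yM1; apply: (le_trans ge_yM1).
  by rewrite (mulrC e) mulrA ler_pM2r // mulrC.
rewrite -ler_ln ?posrE ?divr_gt0 ?expR_gt0 // expRK.
have := le_trans (odds_ge1 M_gt0) (odds_le_ln q01 M_gt0 (ltnW lt_Mn)).
rewrite -[invpow q M / _]invf_div lnV ?posrE ?divr_gt0 // lerN2.
have ln_ge0 : 0 <= ln (invpow q n / invpow q M).
  by rewrite ln_ge0 // ler_pdivlMr // mul1r invpow_homo // ltnW.
move=> /le_trans/(_ (ler_wpM2r ln_ge0 ratio_le)).
by rewrite -ler_pdivrMl // mulr1.
Qed.

(** The success probability is [z] times the odds, which lie between [- ln z] and [invpow_ratio q M]
    times it; [delta] controls that ratio. *)
Lemma success_prob_bounds n M (delta : R) (z := invpow q M / invpow q n) :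
  (M < n)%N -> 0 < delta -> delta <= invpow q M ->
  - (z * ln z) <= success_prob n q (threshold M) <=
  (q^-1 + (q^-1 - 1) / delta) * - (z * ln z).
Proof.
move=> lt_Mn delta_gt0 le_delta; have yM_gt0 := lt_le_trans delta_gt0 le_delta.
have M_gt0 := invpow_gt0_index yM_gt0.
have yn_gt0 : 0 < invpow q n by apply: invpow_gt0; rewrite // (leq_trans _ lt_Mn).
have z_gt0 : 0 < z by exact: divr_gt0.
have ratio_le := invpow_ratio_le delta_gt0 le_delta.
have ln_ge0 : 0 <= ln (invpow q n / invpow q M).
  by rewrite ln_ge0 // ler_pdivlMr // mul1r invpow_homo // ltnW.
rewrite success_prob_odds ?M_gt0 // -/z.
have -> : - (z * ln z) = z * ln (invpow q n / invpow q M).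
  by rewrite -mulrN -lnV ?posrE // invf_div.
rewrite [X in _ && (_ <= X)]mulrCA !ler_pM2l //.
apply/andP; split; first by apply: odds_ge_ln => //; exact: ltnW.
apply: le_trans (odds_le_ln q01 M_gt0 (ltnW lt_Mn)) _.
by rewrite ler_wpM2r.
Qed.

End Squeeze.

(** * Limits along [q n] tending to 1 with [n * (1 - q n)] bounded below *)

Section General.
Variables (R : realType) (q : nat -> R) (c0 : R).
Hypothesis q01 : \forall n \near \oo, 0 < q n < 1.
Hypothesis q_cvg1 : q @ \oo --> (1 : R).
Hypothesis c0_gt0 : 0 < c0.
Hypothesis c0_le : \forall n \near \oo, c0 <= n%:R * (1 - q n).
Local Notation e := (expR (1 : R)).

Lemma cvg_invq : (fun n => (q n)^-1) @ \oo --> (1 : R).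
Proof. by rewrite -[X in _ --> X]invr1; apply: cvgV. Qed.

Lemma cvg_ratio_bound (delta : R) : 0 < delta ->
  (fun n => (q n)^-1 + ((q n)^-1 - 1) / delta) @ \oo --> (1 : R).
Proof.
move=> delta_gt0; rewrite -[X in _ --> X]addr0; apply: cvgD; first exact: cvg_invq.
rewrite -[X in _ --> X](mul0r delta^-1) -(subrr 1).
by apply: cvgMr_tmp; apply: cvgB; [exact: cvg_invq | exact: cvg_cst].
Qed.

Lemma optimal_cvg (M : nat -> nat) : (\forall n \near \oo, (M n < n)%N) ->
  (\forall n \near \oo, optimal n (q n) (threshold (M n))) ->
  (fun n => invpow (q n) (M n) / invpow (q n) n) @ \oo --> e^-1.
Proof.
move=> lt_Mn opt; set T := fun n => (q n)^-1 + ((q n)^-1 - 1) / (c0 / (4 * e)).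
have e_gt0 : 0 < e by exact: expR_gt0.
have cvgT : T @ \oo --> (1 : R) by apply: cvg_ratio_bound; rewrite divr_gt0 ?mulr_gt0.
apply: (@squeeze_cvgr _ _ _ _ (fun n => (e * T n)^-1) (fun n => expR (- (T n)^-1))).
- near=> n; apply: optimal_invpow_bounds => //.
  + by near: n.
  + by near: n.
  + by near: n.
  + by near: n.
  + by near: n; apply: (cvgr_le _ cvg_invq); rewrite ltr1n.
  + near: n; have cvg0 : (fun n => (q n)^-1 - 1) @ \oo --> (0 : R).
      by rewrite -(subrr 1); apply: cvgB; [exact: cvg_invq | exact: cvg_cst].
    by apply: (cvgr_le _ cvg0); rewrite divr_gt0 ?mulr_gt0.
- rewrite -[X in X^-1](mulr1 e); apply: cvgV; first by rewrite mulr1 gt_eqF.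
  exact: cvgMl_tmp.
- rewrite -expRN -[X in - X]invr1; apply: continuous_cvg; first exact: continuous_expR.
  by apply: cvgN; apply: cvgV.
Unshelve. all: by end_near. Qed.

Lemma success_prob_cvg (M : nat -> nat) : (\forall n \near \oo, (M n < n)%N) ->
  (fun n => invpow (q n) (M n) / invpow (q n) n) @ \oo --> e^-1 ->
  (fun n => success_prob n (q n) (threshold (M n))) @ \oo --> e^-1.
Proof.
move=> lt_Mn; set z := fun n => _ => cvgz.
have e_gt0 : 0 < e by exact: expR_gt0.
(* Eventually [z n >= 1 / (2 * e)] and [invpow (q n) n >= c0], so [delta] is a lower bound of
   [invpow (q n) (M n)]. *)
pose delta := c0 / (2 * e); have delta_gt0 : 0 < delta by rewrite divr_gt0 ?mulr_gt0.
have cvgzln : (fun n => - (z n * ln (z n))) @ \oo --> e^-1.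
  have -> : e^-1 = - (e^-1 * ln e^-1) by rewrite lnV ?posrE // expRK mulrN1 opprK.
  apply: cvgN; apply: cvgM => //; apply: continuous_cvg => //.
  by apply: continuous_ln; rewrite invr_gt0.
apply: (@squeeze_cvgr _ _ _ _ (fun n => - (z n * ln (z n)))
   (fun n => ((q n)^-1 + ((q n)^-1 - 1) / delta) * - (z n * ln (z n)))) => //; last first.
  by rewrite -[X in _ --> X]mul1r; apply: cvgM => //; exact: cvg_ratio_bound.
near=> n; have q01n : 0 < q n < 1 by near: n.
have lt_n : (M n < n)%N by near: n.
apply: success_prob_bounds => //.
have yn_gt0 : 0 < invpow (q n) n by apply: invpow_gt0; rewrite // (leq_trans _ lt_n).
have : (2 * e)^-1 <= z n.
  near: n; apply: (cvgr_ge _ cvgz).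
  by rewrite ltf_pV2 ?posrE ?mulr_gt0 // ltr_pMl // ltr1n.
rewrite /z ler_pdivlMr //; apply: le_trans.
rewrite /delta mulrC ler_pM2l ?invr_gt0 ?mulr_gt0 //.
apply: (@le_trans _ _ (n%:R * (1 - q n))); first by near: n.
exact: invpow_ge.
Unshelve. all: by end_near. Qed.

(** The optimal value is attained by some threshold for large [n], hence tends to [1/e] itself. *)
Lemma asymptotically_optimal_cvg (M : nat -> nat) : (\forall n \near \oo, (M n < n)%N) ->
  (fun n => success_prob n (q n) (threshold (M n))) @ \oo --> e^-1 ->
  asymptotically_optimal q (fun n => threshold (M n)).
Proof.
move=> lt_Mn cvg_success.
pose best n := xget 0%N [set m | (m < n)%N /\ optimal n (q n) (threshold m)].
have bestP : \forall n \near \oo, (best n < n)%N /\ optimal n (q n) (threshold (best n)).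
  near=> n; rewrite /best; case: xgetP => [m _ //|no_m].
  have n_gt0 : (0 < n)%N by near: n; exact: nbhs_infty_gt.
  have q01n : 0 < q n < 1 by near: n.
  by have [m lt_mn opt] := ex_optimal_threshold q01n n_gt0; case: (no_m m).
have lt_best : \forall n \near \oo, (best n < n)%N by apply: filterS bestP => n [].
have opt_best : \forall n \near \oo, optimal n (q n) (threshold (best n)).
  by apply: filterS bestP => n [].
have cvg_value : (fun n => optimal_value n (q n)) @ \oo --> e^-1.
  have := success_prob_cvg lt_best (optimal_cvg lt_best opt_best).
  apply: cvg_trans; apply: near_eq_cvg; near=> n.
  apply/esym/optimal_value_eq; near: n; exact: opt_best.
have eV_neq0 : e^-1 != 0 by rewrite invr_eq0 gt_eqF ?expR_gt0.
rewrite /asymptotically_optimal /asymp_equiv -(divff eV_neq0).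
by apply: cvgM => //; apply: cvgV.
Unshelve. all: by end_near. Qed.

End General.

(** * Translating the limit [1/e] of the [invpow] quotient into the growth of [M] *)

Lemma cvg_near_eq (R : realType) (f g : nat -> R) (l : R) :
  (\forall n \near \oo, f n = g n) -> f @ \oo --> l -> g @ \oo --> l.
Proof. by move=> fg; apply: cvg_trans; exact: near_eq_cvg. Qed.

Lemma invpow_expR (R : realType) (q : R) k : 0 < q ->
  invpow q k = expR (k%:R * - ln q) - 1.
Proof. by move=> q_gt0; rewrite expRM_natl expRN lnK. Qed.

Lemma invpow_div (R : realType) (x : R) n m : 0 < x < 1 -> (m < n)%N ->
  invpow x m / invpow x n = (x ^+ (n - m) - x ^+ n) / (1 - x ^+ n).
Proof.
move=> /andP[x_gt0 x_lt1] lt_mn.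
have xn_lt1 : x ^+ n < 1 by rewrite exprn_ilt1 ?ltW // -lt0n (leq_trans _ lt_mn).
rewrite /invpow !exprVn; move: xn_lt1; rewrite -(subnK (ltnW lt_mn)) exprD addnK.
have := exprn_gt0 m x_gt0; have := exprn_gt0 (n - m) x_gt0.
set a := x ^+ m; set b := x ^+ (n - m) => b_gt0 a_gt0 ba_lt1.
by field; rewrite !gt_eqF ?subr_gt0.
Qed.

Section Rates.
Variables (R : realType) (q s : nat -> R) (c : R).
Hypothesis q01 : \forall n \near \oo, 0 < q n < 1.
Hypothesis q_cvg1 : q @ \oo --> (1 : R).
Hypothesis s_gt0 : \forall n \near \oo, 0 < s n.
Hypothesis c_gt0 : 0 < c.
Hypothesis rate : \forall n \near \oo, s n * (1 - q n) = c.
Local Notation e := (expR (1 : R)).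

Lemma onem_le_ln (x : R) : 0 < x -> 1 - x <= - ln x <= (1 - x) / x.
Proof.
move=> x_gt0; apply/andP; split.
  have /le_ln1Dx : -1 < x - 1 by lra.
  by rewrite [1 + _]addrC subrK; lra.
have xV_gt0 : 0 < x^-1 by rewrite invr_gt0.
have /le_ln1Dx : -1 < x^-1 - 1 by lra.
by rewrite [1 + _]addrC subrK lnV // mulrBl mul1r divff // gt_eqF.
Qed.

(** By [onem_le_ln], [- ln (q n)] can replace [1 - q n] when [q n] tends to 1. *)
Lemma cvg_rate : (fun n => s n * - ln (q n)) @ \oo --> c.
Proof.
apply: (@squeeze_cvgr _ _ _ _ (fun=> c) (fun n => c * (q n)^-1)); last first.
- rewrite -[X in _ --> X]mulr1 -[X in _ * X]invr1.
  by apply: cvgM; [exact: cvg_cst | apply: cvgV].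
- exact: cvg_cst.
near=> n; have /andP[qn_gt0 qn_lt1] : 0 < q n < 1 by near: n.
have /andP[lb ub] := onem_le_ln qn_gt0.
have sn_gt0 : 0 < s n by near: n.
have <- : s n * (1 - q n) = c by near: n.
by rewrite ler_pM2l // lb -mulrA ler_pM2l.
Unshelve. all: by end_near. Qed.

Lemma ln_neq0_near : \forall n \near \oo, ln (q n) != 0.
Proof.
near=> n; have /andP[qn_gt0 qn_lt1] : 0 < q n < 1 by near: n.
have /andP[lb _] := onem_le_ln qn_gt0; rewrite -oppr_eq0 gt_eqF //.
by apply: lt_le_trans lb; rewrite subr_gt0.
Unshelve. all: by end_near. Qed.

End Rates.

(** * The regime where [1 - q n] is [c / n] *)

Section Linear.
Variables (R : realType) (q : nat -> R) (c : R).
Hypothesis q01 : \forall n \near \oo, 0 < q n < 1.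
Hypothesis q_cvg1 : q @ \oo --> (1 : R).
Hypothesis c_gt0 : 0 < c.
Hypothesis rate : \forall n \near \oo, n%:R * (1 - q n) = c.
Local Notation e := (expR (1 : R)).

Let n_gt0 : \forall n \near \oo, 0 < n%:R :> R.
Proof. by near=> n; rewrite ltr0n; near: n; exact: nbhs_infty_gt. Unshelve. all: by end_near. Qed.

Lemma rho_arg_gt1 : 1 < 1 + (expR c - 1) / e.
Proof. by rewrite ltrDl divr_gt0 ?expR_gt0 // subr_gt0 expR_gt1. Qed.

Lemma rho_gt0 : 0 < rho c.
Proof. by rewrite mulr_gt0 ?invr_gt0 // ln_gt0 // rho_arg_gt1. Qed.

Lemma mulr_rho : c * rho c = ln (1 + (expR c - 1) / e).
Proof. by rewrite /rho mulrA divff ?mul1r // gt_eqF. Qed.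

Lemma cvg_invpow_nn : (fun n => invpow (q n) n) @ \oo --> expR c - 1.
Proof.
apply: (@cvg_near_eq _ (fun n => expR (n%:R * - ln (q n)) - 1)).
  near=> n; rewrite invpow_expR //.
  by have /andP[] : 0 < q n < 1 by near: n.
apply: cvgB; last exact: cvg_cst.
apply: continuous_cvg; first exact: continuous_expR.
exact: cvg_rate.
Unshelve. all: by end_near. Qed.

(** With [z] the quotient, [1 + z * invpow n = exp (M * - ln q)], and the left side tends to
    [1 + (exp c - 1) / e]. So [M * - ln q] tends to [c * rho c], while [n * - ln q] tends to [c]. *)
Lemma linear_asymp (M : nat -> nat) :
  (fun n => invpow (q n) (M n) / invpow (q n) n) @ \oo --> e^-1 ->
  asymp_equiv (fun n => (M n)%:R) (fun n => n%:R * rho c).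
Proof.
move=> cvgz; have crho_neq0 : c * rho c != 0 by rewrite mulf_neq0 // gt_eqF // rho_gt0.
have cvg_Ml : (fun n => (M n)%:R * - ln (q n)) @ \oo --> c * rho c.
  rewrite mulr_rho (mulrC _ e^-1).
  apply: (@cvg_near_eq _ (fun n => ln (1 + invpow (q n) (M n) / invpow (q n) n * invpow (q n) n))).
    near=> n; have q01n : 0 < q n < 1 by near: n.
    rewrite divfK; last first.
      rewrite gt_eqF // invpow_gt0 //.
      by near: n; exact: nbhs_infty_gt.
    by rewrite invpow_expR ?(andP q01n).1 // addrC subrK expRK.
  apply: continuous_cvg.
    by apply: continuous_ln; rewrite mulrC; apply: lt_trans rho_arg_gt1.
  apply: cvgD; first exact: cvg_cst.
  by apply: cvgM => //; exact: cvg_invpow_nn.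
rewrite /asymp_equiv -[X in _ --> X](divff crho_neq0).
apply: (@cvg_near_eq _ (fun n => (M n)%:R * - ln (q n) / (n%:R * - ln (q n) * rho c))).
  near=> n; have l_neq0 : ln (q n) != 0 by near: n; exact: ln_neq0_near.
  have n_neq0 : n%:R != 0 :> R by rewrite gt_eqF //; near: n.
  have r_neq0 : rho c != 0 by rewrite gt_eqF // rho_gt0.
  move: (rho c) r_neq0 => r r_neq0.
  by field; rewrite n_neq0 l_neq0 r_neq0.
apply: cvgM => //; apply: cvgV => //; apply: cvgM; last exact: cvg_cst.
exact: cvg_rate.
Unshelve. all: by end_near. Qed.

Lemma asymp_linear (M : nat -> nat) :
  asymp_equiv (fun n => (M n)%:R) (fun n => n%:R * rho c) ->
  (fun n => invpow (q n) (M n) / invpow (q n) n) @ \oo --> e^-1.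
Proof.
move=> cvg_ratio.
have ec_gt0 : 0 < expR c - 1 by rewrite subr_gt0 expR_gt1.
have -> : e^-1 = ((1 + (expR c - 1) / e) - 1) / (expR c - 1).
  by field; rewrite !gt_eqF ?expR_gt0.
apply: cvgM; last first.
  by apply: cvgV; [rewrite gt_eqF | exact: cvg_invpow_nn].
apply: (@cvg_near_eq _ (fun n => expR ((M n)%:R * - ln (q n)) - 1)).
  near=> n; rewrite invpow_expR //.
  by have /andP[] : 0 < q n < 1 by near: n.
apply: cvgB; last exact: cvg_cst.
rewrite -[X in _ --> X]lnK; last by rewrite posrE (lt_trans _ rho_arg_gt1).
apply: continuous_cvg; first exact: continuous_expR.
rewrite -mulr_rho -[X in _ --> X]mul1r.
apply: (@cvg_near_eq _ (fun n => (M n)%:R / (n%:R * rho c) * (n%:R * - ln (q n) * rho c))).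
  near=> n; have n_neq0 : n%:R != 0 :> R by rewrite gt_eqF //; near: n.
  have r_neq0 : rho c != 0 by rewrite gt_eqF // rho_gt0.
  move: (rho c) r_neq0 => r r_neq0.
  by field; rewrite n_neq0 r_neq0.
apply: cvgM => //; apply: cvgM; last exact: cvg_cst.
exact: cvg_rate.
Unshelve. all: by end_near. Qed.

End Linear.

(** * The regime where [1 - q n] is [c / s n] with [s n] of smaller order than [n] *)

Section Sublinear.
Variables (R : realType) (q s : nat -> R) (c : R).
Hypothesis q01 : \forall n \near \oo, 0 < q n < 1.
Hypothesis q_cvg1 : q @ \oo --> (1 : R).
Hypothesis c_gt0 : 0 < c.
Hypothesis s_gt0 : \forall n \near \oo, 0 < s n.
Hypothesis rate : \forall n \near \oo, s n * (1 - q n) = c.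
Hypothesis s_sublinear : (fun n => s n / n%:R) @ \oo --> (0 : R).
Local Notation e := (expR (1 : R)).

(** By [invpow_ge], the inverse of [q n ^+ n] is at least [n * (1 - q n) = c * n / s n], which is
    unbounded. *)
Lemma cvg_exprnn : (fun n => q n ^+ n) @ \oo --> (0 : R).
Proof.
apply: (@squeeze_cvgr _ _ _ _ (fun=> 0) (fun n => c^-1 * (s n / n%:R))); last first.
- by rewrite -[X in _ --> X](mulr0 c^-1); apply: cvgM => //; exact: cvg_cst.
- exact: cvg_cst.
near=> n; have q01n : 0 < q n < 1 by near: n.
have /andP[qn_gt0 qn_lt1] := q01n.
have sn_gt0 : 0 < s n by near: n.
have n_gt0 : 0 < n%:R :> R by rewrite ltr0n; near: n; exact: nbhs_infty_gt.
have cE : s n * (1 - q n) = c by near: n.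
apply/andP; split; first by rewrite exprn_ge0 // ltW.
rewrite -[leLHS]invrK -exprVn.
have -> : c^-1 * (s n / n%:R) = (n%:R * (1 - q n))^-1.
  by rewrite -cE; field; rewrite !gt_eqF // subr_gt0.
rewrite lef_pV2 ?posrE ?mulr_gt0 ?subr_gt0 ?exprn_gt0 ?invr_gt0 //.
by apply: (le_trans (invpow_ge q01n n)); rewrite /invpow lerBlDr lerDl.
Unshelve. all: by end_near. Qed.

(** As [x ^+ n] vanishes in this regime, the quotient tends to [1/e] exactly when [(n - M) * - ln q]
    tends to 1, that is when [n - M] is equivalent to [s n / c]. *)
Lemma invpow_divE (x : R) n m : 0 < x < 1 -> (m < n)%N ->
  invpow x m / invpow x n = (expR (- ((n%:R - m%:R) * - ln x)) - x ^+ n) / (1 - x ^+ n).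
Proof.
move=> x01 lt_mn; have /andP[x_gt0 _] := x01.
rewrite invpow_div // -natrB ?(ltnW lt_mn) // mulrN opprK expRM_natl.
by rewrite lnK ?posrE.
Qed.

Lemma sublinear_asymp (M : nat -> nat) : (\forall n \near \oo, (M n < n)%N) ->
  (fun n => invpow (q n) (M n) / invpow (q n) n) @ \oo --> e^-1 ->
  asymp_equiv (fun n => n%:R - (M n)%:R) (fun n => s n / c).
Proof.
move=> lt_Mn cvgz.
have e_gt0 : 0 < e by exact: expR_gt0.
have cvg_l : (fun n => (n%:R - (M n)%:R) * - ln (q n)) @ \oo --> (1 : R).
  have ln_e : - ln e^-1 = 1 by rewrite lnV ?posrE // expRK opprK.
  rewrite -[X in _ --> X]ln_e.
  apply: (@cvg_near_eq _ (fun n => - ln (invpow (q n) (M n) / invpow (q n) n * (1 - q n ^+ n)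
      + q n ^+ n))).
    near=> n; have q01n : 0 < q n < 1 by near: n.
    have /andP[qn_gt0 qn_lt1] := q01n; have lt_n : (M n < n)%N by near: n.
    have qnn_neq0 : 1 - q n ^+ n != 0.
      by rewrite gt_eqF // subr_gt0 exprn_ilt1 ?ltW // -lt0n (leq_trans _ lt_n).
    by rewrite invpow_divE // (divfK qnn_neq0) subrK expRK opprK.
  apply: cvgN; apply: continuous_cvg; first by apply: continuous_ln; rewrite invr_gt0.
  have -> : e^-1 = e^-1 * (1 - 0) + 0 by ring.
  apply: cvgD; last exact: cvg_exprnn.
  by apply: cvgM => //; apply: cvgB; [exact: cvg_cst | exact: cvg_exprnn].
have c_neq0 : c != 0 by rewrite gt_eqF.
have c_div : 1 * c / c = 1 by rewrite mul1r divff.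
rewrite /asymp_equiv -[X in _ --> X]c_div.
apply: (@cvg_near_eq _ (fun n => (n%:R - (M n)%:R) * - ln (q n) * c / (s n * - ln (q n)))).
  near=> n; have l_neq0 : ln (q n) != 0 by near: n; exact: ln_neq0_near.
  have s_neq0 : s n != 0 by rewrite gt_eqF //; near: n.
  by field; rewrite ?l_neq0 ?s_neq0 ?c_neq0.
apply: cvgM; first by apply: cvgM => //; exact: cvg_cst.
by apply: cvgV => //; exact: cvg_rate.
Unshelve. all: by end_near. Qed.

Lemma asymp_sublinear (M : nat -> nat) : (\forall n \near \oo, (M n < n)%N) ->
  asymp_equiv (fun n => n%:R - (M n)%:R) (fun n => s n / c) ->
  (fun n => invpow (q n) (M n) / invpow (q n) n) @ \oo --> e^-1.
Proof.
move=> lt_Mn cvg_ratio; have c_neq0 : c != 0 by rewrite gt_eqF.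
have c_div : 1 * c / c = 1 by rewrite mul1r divff.
have cvg_l : (fun n => (n%:R - (M n)%:R) * - ln (q n)) @ \oo --> (1 : R).
  rewrite -[X in _ --> X]c_div.
  apply: (@cvg_near_eq _ (fun n => (n%:R - (M n)%:R) / (s n / c) * (s n * - ln (q n)) / c)).
    near=> n; have s_neq0 : s n != 0 by rewrite gt_eqF //; near: n.
    by field; rewrite ?c_neq0 ?s_neq0.
  apply: cvgM; last exact: cvg_cst.
  by apply: cvgM => //; exact: cvg_rate.
have -> : e^-1 = (expR (- 1) - 0) / (1 - 0) by rewrite expRN; field; rewrite gt_eqF ?expR_gt0.
apply: (@cvg_near_eq _ (fun n =>
   (expR (- ((n%:R - (M n)%:R) * - ln (q n))) - q n ^+ n) / (1 - q n ^+ n))).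
  near=> n; rewrite invpow_divE //; last by near: n.
  by near: n.
apply: cvgM.
  apply: cvgB; last exact: cvg_exprnn.
  by apply: continuous_cvg; [exact: continuous_expR | exact: cvgN].
apply: cvgV; first by rewrite subr0 oner_neq0.
by apply: cvgB; [exact: cvg_cst | exact: cvg_exprnn].
Unshelve. all: by end_near. Qed.

End Sublinear.

(** * Fixed [q]: the odds of boundedly many last items *)

Section Fixed.
Variables (R : realType) (q : R).
Hypothesis q01 : 0 < q < 1.
Local Notation p := (record_prob q).

Let q_gt0 : 0 < q. Proof. by case/andP: q01. Qed.
Let q_lt1 : q < 1. Proof. by case/andP: q01. Qed.

Lemma odds_ge_size n m : (m < n)%N -> m%:R * (q^-1 - 1) <= odds p n (n - m).
Proof.
move=> lt_mn; have nm_gt0 : (0 < n - m)%N by rewrite subn_gt0.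
rewrite (odds_invpow q01) // mulr_natl.
have -> : (q^-1 - 1) *+ m = \sum_(n - m <= j < n) (q^-1 - 1).
  by rewrite sumr_const_nat subKn // ltnW.
apply: ler_sum_nat => j /andP[le_j _]; have j_gt0 := leq_trans nm_gt0 le_j.
rewrite lerD2r invpow_ratioE // lerDl divr_ge0 ?ltW ?invpow_gt0 //.
by rewrite subr_gt0 invf_gt1.
Qed.

(** Strictness settles the right end [q = L / (L + 1)] of a band, where [L * (q^-1 - 1) = 1] and the
    limit of the odds does not tell their side of 1. *)
Lemma odds_gt_size n m : (0 < m < n)%N -> m%:R * (q^-1 - 1) < odds p n (n - m).
Proof.
case/andP; case: m => // m _ lt_mn.
have nm_gt0 : (0 < n - m.+1)%N by rewrite subn_gt0.
rewrite odds_recl; last by rewrite ltn_subrL (leq_trans _ lt_mn).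
have -> : (n - m.+1).+1 = (n - m)%N by lia.
rewrite -natr1 mulrDl mul1r addrC ltr_leD ?odds_ge_size ?(ltnW lt_mn) //.
have -> : p (n - m.+1) / (1 - p (n - m.+1)) = odds p (n - m.+1).+1 (n - m.+1).
  by rewrite /odds big_nat1.
rewrite (odds_invpow q01) // big_nat1 ltrD2r invpow_ratioE // ltrDl divr_gt0 ?invpow_gt0 //.
by rewrite subr_gt0 invf_gt1.
Qed.

Lemma odds_le_size n m : (m < n)%N ->
  odds p n (n - m) <= m%:R * (invpow_ratio q (n - m) - 1).
Proof.
move=> lt_mn; have nm_gt0 : (0 < n - m)%N by rewrite subn_gt0.
rewrite (odds_invpow q01) // mulr_natl.
have -> : (invpow_ratio q (n - m) - 1) *+ m =
    \sum_(n - m <= j < n) (invpow_ratio q (n - m) - 1).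
  by rewrite sumr_const_nat subKn // ltnW.
by apply: ler_sum_nat => j /andP[le_j _]; rewrite lerD2r invpow_ratio_anti.
Qed.

Lemma cvg_invpow_ratio : invpow_ratio q @ \oo --> q^-1.
Proof.
apply: (@cvg_near_eq _ (fun k => q^-1 + (q^-1 - 1) * (invpow q k)^-1)).
  near=> k; rewrite invpow_ratioE //; near: k; exact: nbhs_infty_gt.
rewrite -[X in _ --> X]addr0 -(mulr0 (q^-1 - 1)); apply: cvgD; first exact: cvg_cst.
apply: cvgM; first exact: cvg_cst.
apply/gtr0_cvgV0.
  near=> k; apply: invpow_gt0 => //; near: k; exact: nbhs_infty_gt.
apply/cvgryPge => A; near=> k; apply: le_trans (invpow_ge q01 k).
rewrite -ler_pdivrMr ?subr_gt0 //; near: k; exact: nbhs_infty_ger.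
Unshelve. all: by end_near. Qed.

Lemma cvg_odds m : (fun n => odds p n (n - m)) @ \oo --> m%:R * (q^-1 - 1).
Proof.
apply: (@squeeze_cvgr _ _ _ _ (fun=> m%:R * (q^-1 - 1))
   (fun n => m%:R * (invpow_ratio q (n - m) - 1))); last first.
- apply: cvgM; first exact: cvg_cst.
  apply: cvgB; last exact: cvg_cst.
  apply: (@cvg_comp _ _ _ (fun n => n - m)%N (invpow_ratio q) _ \oo); last exact: cvg_invpow_ratio.
  exact: cvg_subnr.
- exact: cvg_cst.
near=> n; have lt_mn : (m < n)%N by near: n; exact: nbhs_infty_gt.
by rewrite odds_ge_size ?odds_le_size.
Unshelve. all: by end_near. Qed.

(** The probability of no record among the last [L] items tends to [q ^+ L], their odds to
    [L * (q^-1 - 1)]. *)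
Lemma cvg_success_prob_fixed L : (0 < L)%N ->
  (fun n => success_prob n q (threshold (n - L))) @ \oo --> (1 - q) * q ^+ L.-1 * L%:R.
Proof.
case: L => // L _.
have cvg_qn : (fun n => q ^+ n) @ \oo --> (0 : R).
  by apply: cvg_expr; rewrite ger0_norm ?ltW.
have -> : (1 - q) * q ^+ L.+1.-1 * L.+1%:R =
    (q ^+ L.+1 - 0) / (1 - 0) * (L.+1%:R * (q^-1 - 1)).
  by rewrite exprS /=; field; rewrite gt_eqF.
apply: (@cvg_near_eq _ (fun n => (q ^+ L.+1 - q ^+ n) / (1 - q ^+ n) * odds p n (n - L.+1))).
  near=> n; have lt_Ln : (L.+1 < n)%N by near: n; exact: nbhs_infty_gt.
  rewrite success_prob_odds //; last by rewrite subn_gt0 lt_Ln ltn_subrL (leq_trans _ lt_Ln).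
  by rewrite invpow_div // ?subKn ?(ltnW lt_Ln) // ltn_subrL (leq_trans _ lt_Ln).
apply: cvgM; last exact: cvg_odds.
apply: cvgM; first by apply: cvgB => //; exact: cvg_cst.
apply: cvgV; first by rewrite subr0 oner_neq0.
by apply: cvgB => //; exact: cvg_cst.
Unshelve. all: by end_near. Qed.

(** In this form [L + 1] is the least integer [m] with [1 <= m * (1 - q)], whence existence and
    uniqueness of the band. *)
Lemma band_iff L : band q L <-> (0 < L)%N /\ L%:R * (1 - q) < 1 <= L.+1%:R * (1 - q).
Proof.
split=> -[L_gt0 HL]; split=> //; have L0 : 0 < L%:R :> R by rewrite ltr0n.
  case/andP: HL; rewrite ltr_pdivrMr // ler_pdivlMr ?addr_gt0 // -natr1.
  by move=> lb ub; apply/andP; split; lra.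
case/andP: HL; rewrite -natr1 => lb ub.
rewrite ltr_pdivrMr // ler_pdivlMr ?addr_gt0 //.
by apply/andP; split; lra.
Qed.

(** For large [n] the odds of the last [L - 1] items are below 1 and those of the last [L] above 1,
    so by monotonicity only [n - L] meets the criterion of [optimal_threshold]. *)
Lemma optimal_fixed L : band q L -> \forall n \near \oo, forall M : nat, (M < n)%N ->
  (optimal n q (threshold M) <-> M = (n - L)%N).
Proof.
move=> /band_iff[]; case: L => // L _ /andP[lb ub].
(* The band index is now [L.+1]: [small] concerns the last [L] items, [large] the last [L.+1]. *)
have small : L%:R * (q^-1 - 1) < 1.
  have -> : L%:R * (q^-1 - 1) = (L%:R * (1 - q)) / q by field; rewrite gt_eqF.
  by rewrite ltr_pdivrMr //; move: lb; rewrite -natr1; lra.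
have large : 1 <= L.+1%:R * (q^-1 - 1).
  have -> : L.+1%:R * (q^-1 - 1) = (L.+1%:R * (1 - q)) / q by field; rewrite gt_eqF.
  by rewrite ler_pdivlMr //; move: ub; rewrite -natr1; lra.
have near_odds : \forall n \near \oo, odds p n (n - L) < 1.
  exact: (cvgr_lt _ (@cvg_odds L) _ small).
near=> n => M lt_Mn; have lt_Ln : (L.+1 < n)%N by near: n; exact: nbhs_infty_gt.
have odds_L : odds p n (n - L) < 1 by near: n.
have odds_L1 : 1 < odds p n (n - L.+1) by apply: le_lt_trans large _; exact: odds_gt_size.
have nL1 : (n - L.+1).+1 = (n - L)%N by lia.
have nL_gt0 : (0 < n - L.+1)%N by rewrite subn_gt0.
rewrite (optimal_threshold q01 lt_Mn); split=> [[odds_le1 odds_ge1]|->]; last first.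
  by rewrite nL1; split=> [|_]; exact: ltW.
have [lt_M|lt_M|//] := ltngtP M (n - L.+1)%N.
  have : odds p n (n - L.+1) <= odds p n M.+1.
    by apply: (odds_le (record_prob_gt0 q01) (record_prob_lt1 q01) (record_prob0 q01)); rewrite // lt_M leq_subr.
  by move=> /(lt_le_trans odds_L1)/lt_le_trans/(_ odds_le1); rewrite ltxx.
have M_gt0 : (0 < M)%N by exact: leq_ltn_trans lt_M.
have : odds p n M <= odds p n (n - L).
  apply: (odds_le (record_prob_gt0 q01) (record_prob_lt1 q01) (record_prob0 q01)); first by rewrite -nL1.
  by rewrite -nL1 lt_M ltnW.
by move=> /(le_trans (odds_ge1 M_gt0))/le_lt_trans/(_ odds_L); rewrite ltxx.
Unshelve. all: by end_near. Qed.

Lemma asymptotically_optimal_fixed L : band q L ->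
  asymptotically_optimal (fun=> q) (fun n => threshold (n - L)).
Proof.
move=> bandL; have L_gt0 : (0 < L)%N by case: bandL.
apply: (@cvg_near_eq _ (fun=> 1)); last exact: cvg_cst.
near=> n; have lt_Ln : (L < n)%N by near: n; exact: nbhs_infty_gt.
have lt_nLn : (n - L < n)%N by rewrite ltn_subrL L_gt0 (leq_trans _ lt_Ln).
have opt : optimal n q (threshold (n - L)).
  have optP : forall M : nat, (M < n)%N -> (optimal n q (threshold M) <-> M = (n - L)%N).
    by near: n; exact: optimal_fixed.
  exact/optP.
rewrite (optimal_value_eq opt) divff // gt_eqF // success_prob_odds //; last first.
  by rewrite subn_gt0 lt_Ln.
have nL_gt0 : (0 < n - L)%N by rewrite subn_gt0.
rewrite mulr_gt0 ?divr_gt0 ?invpow_gt0 ?(leq_trans _ lt_Ln) //.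
apply: lt_le_trans (odds_ge_size lt_Ln); rewrite mulr_gt0 ?ltr0n //.
by rewrite subr_gt0 invf_gt1.
Unshelve. all: by end_near. Qed.

Lemma band_Lstar : band q (Lstar q).
Proof.
rewrite /Lstar; case: xgetP => [L _ //|no_band].
have onem_gt0 : 0 < 1 - q by rewrite subr_gt0.
have ex_m : exists m : nat, 1 <= m%:R * (1 - q).
  exists (Num.bound (1 - q)^-1); rewrite -ler_pdivrMr // mul1r ltW //.
  by rewrite archi_boundP // invr_ge0 ltW.
case: (ex_minnP ex_m) => m m_ge m_min; exfalso.
case: m m_ge m_min => [|[|m]]; rewrite ?mul0r ?mul1r ?ler10 //.
  by move=> /le_lt_trans/(_ (_ : 1 - q < 1)); rewrite ltrBlDr ltrDl q_gt0 ltxx => /(_ isT).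
move=> m_ge m_min; apply: (no_band m.+1); apply/band_iff; split=> //.
rewrite m_ge andbT ltNge; apply/negP => /m_min; by rewrite ltnn.
Qed.

Lemma band_inj L L' : band q L -> band q L' -> L = L'.
Proof.
have onem_gt0 : 0 < 1 - q by rewrite subr_gt0.
suff le_band K K' : band q K -> band q K' -> (K <= K')%N.
  by move=> b b'; apply/eqP; rewrite eqn_leq !le_band.
move=> /band_iff[_ /andP[lb _]] /band_iff[_ /andP[_ ub]].
by have := lt_le_trans lb ub; rewrite ltr_pM2r // ltr_nat ltnS.
Qed.

Lemma limit_successE : limit_success q = (1 - q) * q ^+ (Lstar q).-1 * (Lstar q)%:R.
Proof. by apply/cvg_lim => //; apply: cvg_success_prob_fixed; case: band_Lstar. Qed.

Lemma bernoulli (x : R) n : -1 <= x -> 1 + n%:R * x <= (1 + x) ^+ n.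
Proof.
move=> x_ge; elim: n => [|n IH]; first by rewrite mul0r addr0.
rewrite exprS; apply: (@le_trans _ _ ((1 + x) * (1 + n%:R * x))).
  have : 0 <= n%:R * (x * x) by rewrite mulr_ge0 // -expr2 sqr_ge0.
  by rewrite -natr1; lra.
by rewrite ler_wpM2l //; lra.
Qed.

(** This is [(1 + 1/k)^k < e] for [k = m + 1], inverted; the right side is the limiting success
    probability at the right end of the band [m + 1]. *)
Lemma band_bound_gt m : (expR 1)^-1 < (m.+1%:R / m.+2%:R : R) ^+ m.+1.
Proof.
have -> : (m.+1%:R / m.+2%:R : R) = (1 + m.+1%:R^-1)^-1.
  have : 0 < m.+1%:R :> R by rewrite ltr0n.
  rewrite -[m.+2%:R]natr1; move: (m.+1%:R : R) => k k_gt0.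
  by field; rewrite !gt_eqF ?addr_gt0.
rewrite exprVn ltf_pV2 ?posrE ?expR_gt0 ?exprn_gt0 ?addr_gt0 //.
have -> : expR 1 = expR (m.+1%:R^-1) ^+ m.+1 :> R.
  by rewrite -expRM_natl divff // pnatr_eq0.
have mV_gt0 : 0 < m.+1%:R^-1 :> R by rewrite invr_gt0 ltr0n.
by rewrite ltrXn2r // ?expR_gt1Dx ?gt_eqF // addr_ge0 // ltW.
Qed.

(* On a band, [(1 - q) q^(L-1)] is decreasing in [q] (by Bernoulli's inequality),
   so the minimum is attained at the right end [q = L / (L + 1)]. *)
Lemma limit_success_gt : (expR 1)^-1 < limit_success q.
Proof.
rewrite limit_successE; have /band_iff[] := band_Lstar.
case: (Lstar q) => // m _ /andP[]; rewrite /= => lb ub.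
apply: (lt_le_trans (band_bound_gt m)).
set r : R := m.+1%:R / m.+2%:R.
have m1 : 0 < m.+1%:R :> R by rewrite ltr0n.
have m2 : m.+2%:R = m.+1%:R + 1 :> R by rewrite natr1.
have m2_gt0 : 0 < m.+2%:R :> R by rewrite ltr0n.
have r_gt0 : 0 < r by rewrite divr_gt0.
have -> : r ^+ m.+1 = (1 - r) * r ^+ m * m.+1%:R.
  rewrite exprSr (mulrC (1 - r)) -mulrA; congr (_ * _).
  rewrite /r m2; move: (m.+1%:R : R) m1 => k k_gt0.
  by field; rewrite gt_eqF ?addr_gt0.
rewrite ler_pM2r //.
have le_qr : q <= r by rewrite /r ler_pdivlMr // m2; move: ub; rewrite m2; lra.
(* The left end of the band gives [(m + 1) * (1 - q) < 1], and [m * (m + 2) <= (m + 1)^2]. *)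
have le_r : m%:R * (1 - q) <= r.
  have := ler_wpM2l (ltW m1) (ltW lb).
  by rewrite /r ler_pdivlMr // m2 -[m.+1%:R]natr1; move: q_lt1; lra.
pose t := q / r; have def_q : q = t * r by rewrite divfK // gt_eqF.
have t_ge0 : 0 <= t by rewrite divr_ge0 ?ltW.
have t_le1 : t <= 1 by rewrite ler_pdivrMr // mul1r.
have bern : 1 + m%:R * (t - 1) <= t ^+ m.
  by rewrite -[X in X ^+ m](subrKC 1); apply: bernoulli; lra.
rewrite -subr_ge0 in bern.
have -> : q ^+ m = t ^+ m * r ^+ m by rewrite -exprMn -def_q.
rewrite [leRHS]mulrA; apply: ler_wpM2r; first by rewrite exprn_ge0 // ltW.
have onemq_ge0 : 0 <= 1 - q by rewrite subr_ge0 ltW.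
(* As [t * r = q], [(1 - q) * (1 - m * (1 - t)) >= (1 - q) - r * (1 - t) = 1 - r]. *)
have := mulr_ge0 onemq_ge0 bern.
have : 0 <= (1 - t) * (r - m%:R * (1 - q)) by rewrite mulr_ge0 // subr_ge0.
have : t * r = q by [].
set T := t ^+ m; set k := m%:R.
nra.
Qed.

(** For [L = Lstar q], [L * (1 - q) < 1] leaves [q ^+ (L - 1)], at most [exp (- (L - 1) * (1 - q))];
    and [(L + 1) * (1 - q) >= 1] gives [(L - 1) * (1 - q) >= 2 * q - 1]. *)
Lemma limit_success_le : limit_success q <= expR (1 - 2 * q).
Proof.
rewrite limit_successE; have /band_iff[] := band_Lstar.
case: (Lstar q) => // m _ /andP[]; rewrite /= => lb ub.
have -> : (1 - q) * q ^+ m * m.+1%:R = q ^+ m * (m.+1%:R * (1 - q)) by ring.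
apply: (@le_trans _ _ (q ^+ m)).
  by rewrite ler_piMr ?exprn_ge0 ?(ltW q_gt0) ?(ltW lb).
apply: (@le_trans _ _ (expR (- (m%:R * (1 - q))))).
  rewrite -mulrN expRM_natl lerXn2r ?nnegrE ?expR_ge0 ?(ltW q_gt0) //.
  by have := expR_ge1Dx (- (1 - q)); lra.
rewrite ler_expR; move: ub; rewrite -[m.+2%:R]natr1 -[m.+1%:R]natr1; lra.
Qed.

End Fixed.

(** * Limits of [rho] at infinity and at 0 *)

Lemma rho_cvg_pinfty (R : realType) : @rho R c @[c --> +oo%R] --> (1 : R).
Proof.
(* For [c > 0], [exp (c - 1) <= 1 + (exp c - 1) / e <= exp c]. *)
apply: (@squeeze_cvgr _ _ _ _ (fun c : R => 1 - c^-1) (fun=> 1)).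
- near=> c; have c_gt0 : 0 < c by near: c; exact: nbhs_pinfty_gt.
  have e_gt1 : 1 < expR 1 :> R by rewrite expR_gt1.
  have ec_gt0 := expR_gt0 c.
  have ec_gt1 : 1 < expR c by rewrite expR_gt1.
  have arg_gt0 : 0 < 1 + (expR c - 1) / expR 1.
    by rewrite addr_gt0 // divr_gt0 ?expR_gt0 // subr_gt0.
  have -> : 1 - c^-1 = c^-1 * (c - 1) by field; rewrite gt_eqF.
  rewrite /rho ler_pM2l ?invr_gt0 //; apply/andP; split.
    rewrite -ler_expR lnK // expRD expRN.
    have : (expR 1)^-1 <= 1 :> R by rewrite invf_le1 ?expR_gt0 // ltW.
    by rewrite mulrBl mul1r; lra.
  rewrite ler_pdivrMl // mulr1 -ler_expR lnK //.
  have : (expR c - 1) / expR 1 <= expR c - 1.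
    by rewrite ler_piMr ?invf_le1 ?expR_gt0 ?ltW // subr_gt0.
  lra.
- rewrite -[X in _ --> X]subr0; apply: cvgB; first exact: cvg_cst.
  apply/gtr0_cvgV0; last exact: cvg_id.
  exact: nbhs_pinfty_gt.
- exact: cvg_cst.
Unshelve. all: by end_near. Qed.

(* The numerator of [rho] vanishes at 0, so this limit is its derivative there. *)
Lemma rho_cvg0 (R : realType) : @rho R c @[c --> (0 : R)^'] --> (expR 1 : R)^-1.
Proof.
pose f (c : R) := ln (1 + (expR c - 1) / expR 1).
have arg0 : 1 + (expR 0 - 1) / expR 1 = 1 :> R by rewrite expR0 subrr mul0r addr0.
have df : is_derive (0 : R) 1 f (expR 1)^-1.
  pose g (c : R) := 1 + (expR c - 1) / expR 1.
  have dln : is_derive (g 0) 1 (@ln R) 1^-1.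
    by rewrite /g arg0; apply: is_derive1_ln.
  have dg : is_derive (0 : R) 1 g (expR 1)^-1.
    have -> : g = cst 1 + (expR 1)^-1 \*: (expR - cst 1).
      by apply/funext => c; rewrite /g /= !fctE [RHS]/(1 + _ * _) mulrC.
    have dE : (expR 1)^-1 = 0 + (expR 1)^-1 *: (expR 0 - 0) :> R.
      by rewrite expR0 subr0 add0r; exact/esym/mulr1.
    by rewrite [X in is_derive _ _ _ X]dE; apply: is_deriveD.
  by have := @is_derive1_comp _ (@ln R) g _ _ _ dln dg; rewrite invr1 mul1r.
have [df1 dfE] := df.
rewrite -dfE.
have -> : @rho R = (fun h => h^-1 *: ((f \o shift 0) (h *: 1) - f 0)).
  by apply/funext => h; rewrite /rho /f /= arg0 ln1 subr0 addr0 [h *: 1]mulr1.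
exact: df1.
Qed.

(** * Schedules [q n = 1 - c / s n] with [s n] tending to infinity *)

Lemma cvg_powR_pinfty (R : realType) (alpha : R) : 0 < alpha ->
  (fun n : nat => n%:R `^ alpha) @ \oo --> +oo%R.
Proof.
move=> alpha_gt0; apply/cvgryPge => A.
pose B := Num.max A 0; have B_ge0 : 0 <= B by rewrite le_max lexx orbT.
near=> n; apply: (@le_trans _ _ B); first by rewrite le_max lexx.
have -> : B = (B `^ alpha^-1) `^ alpha.
  by rewrite -powRrM mulVf ?gt_eqF // powRr1.
apply: ge0_ler_powR; rewrite ?nnegrE ?powR_ge0 ?(ltW alpha_gt0) //.
by near: n; exact: nbhs_infty_ger.
Unshelve. all: by end_near. Qed.

Lemma cvg_div_pinfty (R : realType) (c : R) (s : nat -> R) :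
  s @ \oo --> +oo%R -> (fun n => c / s n) @ \oo --> (0 : R).
Proof.
move=> cvgs; rewrite -[X in _ --> X](mulr0 c); apply: cvgM; first exact: cvg_cst.
apply/gtr0_cvgV0 => //.
exact: (cvgry_gt cvgs).
Qed.

Section Schedule.
Variables (R : realType) (c : R) (s : nat -> R).
Hypothesis c_gt0 : 0 < c.
Hypothesis cvgs : s @ \oo --> +oo%R.
Let q n := 1 - c / s n.

Lemma schedule_gt0 : \forall n \near \oo, 0 < s n.
Proof. exact: (cvgry_gt cvgs). Qed.

Lemma schedule01 : \forall n \near \oo, 0 < q n < 1.
Proof.
near=> n; have lt_cs : c < s n by near: n; exact: (cvgry_gt cvgs).
have s_gt0 := lt_trans c_gt0 lt_cs.
by rewrite /q subr_gt0 ltrBlDr ltrDl divr_gt0 // ltr_pdivrMr // mul1r lt_cs.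
Unshelve. all: by end_near. Qed.

Lemma schedule_cvg1 : q @ \oo --> (1 : R).
Proof.
rewrite -[X in _ --> X]subr0; apply: cvgB; first exact: cvg_cst.
exact: cvg_div_pinfty.
Qed.

Lemma schedule_rate : \forall n \near \oo, s n * (1 - q n) = c.
Proof.
near=> n; have s_gt0 : 0 < s n by near: n; exact: schedule_gt0.
by rewrite /q; field; rewrite gt_eqF.
Unshelve. all: by end_near. Qed.

Lemma schedule_ge : (\forall n \near \oo, s n <= n%:R) ->
  \forall n \near \oo, c <= n%:R * (1 - q n).
Proof.
move=> s_le; near=> n; have /andP[_ qn_lt1] : 0 < q n < 1 by near: n; exact: schedule01.
have <- : s n * (1 - q n) = c by near: n; exact: schedule_rate.
by rewrite ler_wpM2r ?subr_ge0 ?(ltW qn_lt1) //; near: n.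
Unshelve. all: by end_near. Qed.

Lemma schedule_ex_optimal : \forall n \near \oo, exists2 M : nat, (M < n)%N &
  optimal n (q n) (threshold M).
Proof.
near=> n; have q01n : 0 < q n < 1 by near: n; exact: schedule01.
apply: ex_optimal_threshold => //; near: n; exact: nbhs_infty_gt.
Unshelve. all: by end_near. Qed.

Hypothesis s_le : \forall n \near \oo, s n <= n%:R.

(** Common core of (i) and (ii), with [s n] equal to [n] or to its power [alpha]; only the
    equivalence between [asymptotics] and the limit [1/e] of the quotient depends on the regime. *)
Lemma schedule_theorem (M : nat -> nat) (asymptotics : Prop) :
  (\forall n \near \oo, (M n < n)%N) ->
  ((fun n => invpow (q n) (M n) / invpow (q n) n) @ \oo --> (expR 1)^-1 <-> asymptotics) ->
  [/\ (\forall n \near \oo, optimal n (q n) (threshold (M n))) -> asymptotics,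
      asymptotics -> asymptotically_optimal q (fun n => threshold (M n))
    & asymptotics -> (fun n => success_prob n (q n) (threshold (M n))) @ \oo --> (expR 1)^-1].
Proof.
move=> lt_Mn asymP.
have q01 := schedule01; have q_cvg1 := schedule_cvg1; have c_le := schedule_ge s_le.
have limM : asymptotics ->
    (fun n => success_prob n (q n) (threshold (M n))) @ \oo --> (expR 1)^-1.
  by move=> /asymP; exact: (success_prob_cvg q01 q_cvg1 c_gt0 c_le lt_Mn).
split=> //.
- by move=> opt; apply/asymP; exact: (optimal_cvg q01 q_cvg1 c_gt0 c_le lt_Mn opt).
- move=> /limM; exact: (asymptotically_optimal_cvg q01 q_cvg1 c_gt0 c_le lt_Mn).
Qed.

End Schedule.

(** * The fixed-[q] limit near [q = 1] and for [q <= 1/2] *)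

Lemma limit_success_cvg (R : realType) :
  @limit_success R q @[q --> (1 : R)^'-] --> (expR 1 : R)^-1.
Proof.
apply: (@squeeze_cvgr _ _ _ _ (fun=> (expR 1)^-1) (fun q : R => expR (1 - 2 * q))).
- near=> q; have q01 : 0 < q < 1.
    apply/andP; split; near: q; [exact: nbhs_left_gt | exact: nbhs_left_lt].
  by rewrite (ltW (limit_success_gt q01)) limit_success_le.
- exact: cvg_cst.
- apply: cvg_at_left_filter.
  have -> : (expR 1)^-1 = expR (1 - 2 * 1) :> R by rewrite -expRN; congr expR; ring.
  apply: continuous_cvg; first exact: continuous_expR.
  apply: cvgB; first exact: cvg_cst.
  by apply: cvgM; [exact: cvg_cst | exact: cvg_id].
Unshelve. all: by end_near. Qed.

Lemma limit_success_half (R : realType) (q : R) : 0 < q <= 2^-1 -> limit_success q = 1 - q.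
Proof.
move=> /andP[q_gt0 q_le]; have q01 : 0 < q < 1 by rewrite q_gt0 /=; lra.
have band1 : band q 1.
  by apply/band_iff; split=> //; apply/andP; split; lra.
by rewrite (limit_successE q01) (band_inj q01 (band_Lstar q01) band1) expr0 !mulr1.
Qed.

Theorem theorem1 (R : realType) :
  [/\
   (* (i) *)
   [/\ (forall c : R, 0 < c ->
          let q := fun n : nat => 1 - c / n%:R in
          (\forall n \near \oo, exists2 M : nat, (M < n)%N &
             optimal n (q n) (threshold M))
          /\
          (forall M : nat -> nat, (\forall n \near \oo, (M n < n)%N) ->
             [/\ (\forall n \near \oo, optimal n (q n) (threshold (M n))) ->
                   asymp_equiv (fun n => (M n)%:R) (fun n => n%:R * rho c),
                 asymp_equiv (fun n => (M n)%:R) (fun n => n%:R * rho c) ->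
                   asymptotically_optimal q (fun n => threshold (M n))
               & asymp_equiv (fun n => (M n)%:R) (fun n => n%:R * rho c) ->
                   (fun n => success_prob n (q n) (threshold (M n))) @ \oo
                     --> (expR 1)^-1])),
       @rho R c @[c --> +oo%R] --> (1 : R)
     & @rho R c @[c --> (0 : R)^'] --> (expR 1 : R)^-1],
   (* (ii) *)
   (forall c alpha : R, 0 < c -> 0 < alpha < 1 ->
      let q := fun n : nat => 1 - c / (n%:R `^ alpha) in
      (\forall n \near \oo, exists2 M : nat, (M < n)%N &
         optimal n (q n) (threshold M))
      /\
      (forall M : nat -> nat, (\forall n \near \oo, (M n < n)%N) ->
         [/\ (\forall n \near \oo, optimal n (q n) (threshold (M n))) ->
               asymp_equiv (fun n => n%:R - (M n)%:R)
                           (fun n => (n%:R `^ alpha) / c),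
             asymp_equiv (fun n => n%:R - (M n)%:R)
                         (fun n => (n%:R `^ alpha) / c) ->
               asymptotically_optimal q (fun n => threshold (M n))
           & asymp_equiv (fun n => n%:R - (M n)%:R)
                         (fun n => (n%:R `^ alpha) / c) ->
               (fun n => success_prob n (q n) (threshold (M n))) @ \oo
                 --> (expR 1)^-1]))
   (* (iii) *)
   & [/\ (forall q : R, 0 < q < 1 -> band q (Lstar q)),
         (forall (q : R) (L : nat), 0 < q < 1 -> band q L ->
            [/\ (\forall n \near \oo, forall M : nat, (M < n)%N ->
                   (optimal n q (threshold M) <-> M = (n - L)%N)),
                asymptotically_optimal (fun=> q) (fun n => threshold (n - L))
              & (fun n => success_prob n q (threshold (n - L))) @ \oo
                  --> (1 - q) * q ^+ L.-1 * L%:R])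
       & [/\ (forall q : R, 0 < q < 1 -> (expR 1)^-1 < limit_success q),
             @limit_success R q @[q --> (1 : R)^'-] --> (expR 1 : R)^-1
           & (forall q : R, 0 < q <= 2^-1 -> limit_success q = 1 - q)]]].
Proof.
split.
- split; [|exact: rho_cvg_pinfty|exact: rho_cvg0].
  move=> c c_gt0 q; have cvgs : (fun n : nat => n%:R : R) @ \oo --> +oo%R by exact: cvgr_idn.
  split=> [|M lt_Mn]; first exact: schedule_ex_optimal.
  have q01 : \forall n \near \oo, 0 < q n < 1 by exact: schedule01.
  have q_cvg1 : q @ \oo --> (1 : R) by exact: schedule_cvg1.
  have rate : \forall n \near \oo, n%:R * (1 - q n) = c by exact: schedule_rate.
  apply: schedule_theorem => //; first exact: nearW.
  by split; [exact: linear_asymp | exact: asymp_linear].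
- move=> c alpha c_gt0 /andP[alpha_gt0 alpha_lt1] q.
  have cvgs := @cvg_powR_pinfty R alpha alpha_gt0.
  split=> [|M lt_Mn]; first exact: schedule_ex_optimal.
  have q01 : \forall n \near \oo, 0 < q n < 1 by exact: schedule01.
  have q_cvg1 : q @ \oo --> (1 : R) by exact: schedule_cvg1.
  have rate : \forall n \near \oo, n%:R `^ alpha * (1 - q n) = c by exact: schedule_rate.
  have s_gt0 := schedule_gt0 cvgs.
  have sublinear : (fun n : nat => n%:R `^ alpha / n%:R) @ \oo --> (0 : R).
    (* The quotient is the inverse of [n] to the power [1 - alpha]. *)
    have beta_gt0 : 0 < 1 - alpha by rewrite subr_gt0.
    apply: cvg_near_eq (@cvg_div_pinfty R 1 _ (@cvg_powR_pinfty R _ beta_gt0)).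
    near=> n; have n_gt0 : 0 < n%:R :> R by rewrite ltr0n; near: n; exact: nbhs_infty_gt.
    have n_neq0 : n%:R != 0 :> R by rewrite gt_eqF.
    by rewrite div1r -powRN opprB powRB ?n_neq0 ?implybT // powRr1 // ltW.
  apply: schedule_theorem => //.
    near=> n; apply: ler1_powR; last exact: ltW.
    by rewrite ler1n; near: n; exact: nbhs_infty_gt.
  by split; [exact: sublinear_asymp | exact: asymp_sublinear].
- split; first exact: band_Lstar.
    move=> q L q01 bandL; split; [exact: optimal_fixed | exact: asymptotically_optimal_fixed |].
    by apply: cvg_success_prob_fixed => //; case: bandL.
  by split; [exact: limit_success_gt | exact: limit_success_cvg | exact: limit_success_half].
Unshelve. all: by end_near. Qed.
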